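(* Let $n=\sigma^2\ge 10$ with $\sigma$ a positive integer. Let $k$ be any nonnegative integer, and let $m=x+k(\sigma-1)$, where $x$ is an integer satisfying $\sigma/2-l_{\sigma}\le x\le \sigma/2$ if $\sigma$ is even, or $(\sigma+1)/2-l_{2\sigma}\le x\le(\sigma+1)/2$ if $\sigma$ is odd. Then $$h(n;m)(t)=\max\left(0,\binom{t+2}{2}-n\binom{m+1}{2}\right)\quad\text{for each integer } t\ge 0.$$
   Context: Work over the complex numbers. For integers $n\ge1$, $m\ge0$, fix $n$ general points of $\mathbf{P}^2$ (''general'' means in a suitable nonempty Zariski open set of $n$-tuples, which may depend on $n$ and $m$). $I(n;m)\subset \mathbf{C}[\mathbf{P}^2]$ is the homogeneous ideal generated by all forms having multiplicity at least $m$ at each of the $n$ points, and $h(n;m)(t)=\dim_{\mathbf{C}} I(n;m)_t$ for integers $t\ge0$. For a positive integer $i$, $l_i$ denotes the largest integer $j$ such that $j(j+1)\le i$. *)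

(* Defs.v *)
From HB Require Import structures.
From mathcomp Require Import all_boot all_order all_algebra.
From mathcomp Require Import boolp reals.
From mathcomp Require Export complex mpoly.

Set Implicit Arguments.
Unset Strict Implicit.
Unset Printing Implicit Defensive.

Import Order.TTheory GRing.Theory Num.Theory.
Local Open Scope ring_scope.

Definition ell (i : nat) : nat := \max_(j < i.+1 | (j * j.+1 <= i)%N) j.

Lemma ellP (i : nat) :
  (ell i * (ell i).+1 <= i)%N /\
  (forall j : nat, (j * j.+1 <= i)%N -> (j <= ell i)%N).
Proof.
split; last first.
  move=> j Hj; have j_lt : (j < i.+1)%N.
    by rewrite ltnS; apply: leq_trans Hj; rewrite leq_pmulr.
  exact: (@leq_bigmax_cond _ (fun k : 'I_i.+1 => (k * k.+1 <= i)%N)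
            (fun k : 'I_i.+1 => k : nat) (Ordinal j_lt) Hj).
rewrite /ell; elim/big_ind: _ => // a b Ha Hb.
by rewrite /maxn; case: ifP.
Qed.

Section ProjectivePlane.

Variable K : fieldType.

(* A point of P^2 is given by a vector of homogeneous coordinates. All the
   notions below depend on these coordinates only up to a nonzero scalar. *)
Definition point : Type := {v : 'rV[K]_3 | v != 0}.

Definition hcoord (p : point) (j : 'I_3) : K := val p 0 j.

(* The affine equation of the form f in the chart x_i <> 0, the affine
   coordinates being translated so that p becomes the origin. *)
Definition local_eq (f : {mpoly K[3]}) (p : point) (i : 'I_3) : {mpoly K[2]} :=
  f \mPo [tuple if unlift i j is Some j'
                then 'X_j' + (hcoord p j / hcoord p i)%:MP else 1 | j < 3].

(* Only the charts containing p are relevant, and they all give the same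
   multiplicity; the zero form has multiplicity at least m for every m. *)
Definition mult_ge (m : nat) (f : {mpoly K[3]}) (p : point) : Prop :=
  forall i : 'I_3, hcoord p i != 0 ->
    {in msupp (local_eq f p i), forall a, (m <= mdeg a)%N}.

Definition ideal_gen (k : nat) (G : {mpoly K[k]} -> Prop) (f : {mpoly K[k]}) :
    Prop :=
  exists2 s : seq ({mpoly K[k]} * {mpoly K[k]}),
    {in s, forall q, G q.2} & f = \sum_(q <- s) q.1 * q.2.

Definition fat_form (n : nat) (P : 'I_n -> point) (m : nat) (f : {mpoly K[3]}) :
    Prop :=
  (exists d : nat, f \is d.-homog) /\ (forall i : 'I_n, mult_ge m f (P i)).

Definition fat_ideal (n : nat) (P : 'I_n -> point) (m : nat) :
    {mpoly K[3]} -> Prop :=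
  ideal_gen (fat_form P m).

Lemma ex_vspace (V : vectType K) (S : V -> Prop) :
  S 0 -> (forall (a : K) (u v : V), S u -> S v -> S (a *: u + v)) ->
  exists U : {vspace V}, forall u : V, u \in U <-> S u.
Proof.
move=> S0 SL.
pose Q d := `[< exists2 U : {vspace V}, \dim U = d & {in U, forall u, S u} >].
have Q0 : exists d, Q d.
  exists 0%N; apply/asboolP; exists 0%VS; first by rewrite dimv0.
  by move=> u; rewrite memv0 => /eqP ->.
have Qub d : Q d -> (d <= \dim {:V})%N.
  by move=> /asboolP[U <- _]; rewrite dimvS ?subvf.
case: (ex_maxnP Q0 Qub) => d /asboolP[U dU SU] dmax.
exists U => u; split=> [|Su]; first exact: SU.
apply: contrapT => /negP uU.
have : Q (\dim (U + <[u]>)%VS).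
  apply/asboolP; exists (U + <[u]>)%VS => // w /memv_addP[w1 w1U [w2 + ->]].
  by move=> /vlineP[a ->]; rewrite addrC; apply: SL => //; apply: SU.
move=> /dmax; rewrite leqNgt => /negP; apply.
rewrite -dU (ltn_leqif (dimv_leqif_sup (addvSl U <[u]>%VS))).
by rewrite subv_add subvv /= -memvE.
Qed.

Lemma ex_ideal_piece (k : nat) (G : {mpoly K[k.+1]} -> Prop) (t : nat) :
  exists U : {vspace dhomog k.+1 K t},
    forall f : dhomog k.+1 K t, f \in U <-> ideal_gen G (f : {mpoly K[k.+1]}).
Proof.
apply: ex_vspace => [|a f g [s Gs fE] [s' Gs' gE]].
  by exists [::] => //; rewrite big_nil.
exists ([seq (a *: q.1, q.2) | q <- s] ++ s').
  by move=> q; rewrite mem_cat => /orP[/mapP[r /Gs ? ->]|/Gs'].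
rewrite linearP /= fE gE big_cat big_map /= scaler_sumr; congr (_ + _).
by apply: eq_bigr => q _; rewrite scalerAl.
Qed.

(* The space I(n;m)_t of the elements of degree t of the ideal, and its
   dimension h(n;m)(t). *)
Definition fat_piece (n : nat) (P : 'I_n -> point) (m t : nat) :
    {vspace dhomog 3 K t} :=
  sval (cid (ex_ideal_piece (fat_form P m) t)).

Lemma fat_pieceP (n : nat) (P : 'I_n -> point) (m t : nat) (f : dhomog 3 K t) :
  f \in fat_piece P m t <-> fat_ideal P m f.
Proof. exact: (svalP (cid (ex_ideal_piece (fat_form P m) t)) f). Qed.

Definition hilb (n : nat) (P : 'I_n -> point) (m t : nat) : nat :=
  \dim (fat_piece P m t).

(* F is homogeneous separately in each of the n triples of variables; the
   variable of index mxvec_index i j is the j-th coordinate of the i-th point. *)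
Definition multihomog (n : nat) (F : {mpoly K[n * 3]}) : Prop :=
  exists d : 'I_n -> nat, {in msupp F, forall a : 'X_{1..n * 3},
    forall i : 'I_n, (\sum_(j < 3) a (mxvec_index i j))%N = d i}.

Definition eval_points (n : nat) (F : {mpoly K[n * 3]}) (P : 'I_n -> point) : K :=
  F.@[fun l => mxvec (\matrix_(i < n, j < 3) hcoord (P i) j) 0 l].

(* Open sets are the complements of the common zero loci of families of
   multihomogeneous polynomials. *)
Definition zariski_open (n : nat) (U : ('I_n -> point) -> Prop) : Prop :=
  exists2 E : {mpoly K[n * 3]} -> Prop,
    (forall F, E F -> multihomog F) &
    (forall P, U P <-> exists2 F, E F & eval_points F P != 0).

Definition for_general_points (n : nat) (Q : ('I_n -> point) -> Prop) : Prop :=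
  exists U : ('I_n -> point) -> Prop,
    [/\ zariski_open U, exists P, U P & forall P, U P -> Q P].

End ProjectivePlane.

(* Main.v *)
(** Write m = x + k (sigma - 1) and let s be the integer with 2s + 4 = sigma or
    2s + 5 = sigma. It is enough that no form of degree m sigma + s has multiplicity m
    at general points, and that the multiplicity conditions are independent in degree
    m sigma + s + 1. Both say that a matrix has maximal rank, an open condition, so each
    may be checked on a degeneration: let the n points move along a smooth germ
    v = y - psi(u) = 0 and collapse to the origin. The limit of the fat point ideals
    consists of the f whose monomials u^a v^b all satisfy a + n b >= n m.

    For independence take psi = (1 + u)^sigma: restricting to that curve and dividing
    by its equation lowers m by 1 and the degree by sigma. For the vanishing let the
    germ have contact of order r = sigma (sigma - 1) with y = (1 + u)^(sigma - 1). A
    polynomial of valuation at least M restricts to the curve with a zero of order at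
    least that expected from M; if the restriction is forced to vanish, division by the
    equation lowers the degree by sigma - 1 and M by r. Both arguments use that on the
    toric curve y = x^d a restriction is a combination of few monomials in x, hence
    cannot vanish at x = 1 to an order as large as their number in characteristic 0. *)

From HB Require Import structures.
Require Import Defs.
From mathcomp Require Import all_boot all_order all_algebra reals.
From mathcomp Require Import perm zify ring.

Set Implicit Arguments.
Unset Strict Implicit.
Unset Printing Implicit Defensive.

Import Order.TTheory GRing.Theory Num.Theory.
Local Open Scope ring_scope.

(** * Fewnomials at 1 *)

Section Fewnomials.

Variable K : fieldType.
Hypothesis charK : [pchar K] =i pred0.

Lemma natr_eq0_pchar0 (k : nat) : (k%:R == 0 :> K) = (k == 0)%N.
Proof. exact: (iffLR (pcharf0P K) charK). Qed.

Lemma dvdp_Xn_coef (k : nat) (p : {poly K}) :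
  reflect (forall i, (i < k)%N -> p`_i = 0) ('X^k %| p).
Proof.
apply: (iffP idP) => [/dvdpP[q ->] i ik|p0]; first by rewrite coefMXn ik.
apply/dvdpP; exists (drop_poly k p); rewrite -{1}(poly_take_drop k p).
rewrite [take_poly k p](_ : _ = 0) ?add0r //.
by apply/polyP=> i; rewrite coef_take_poly coef0; case: ifP => // /p0.
Qed.

Lemma natr_inj_pchar0 : injective (fun k : nat => k%:R : K).
Proof.
move=> a b /eqP; wlog le_ab : a b / (a <= b)%N => [W ab|].
  by have [/W|/ltnW/W W'] := leqP a b; [apply | rewrite W' // eq_sym].
by rewrite eq_sym -subr_eq0 -natrB // natr_eq0_pchar0; lia.
Qed.

(* The operator x d/dx - e kills x^e, rescales the other monomials and lowers
   the order of vanishing at 1 by at most one. *)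
Lemma sparse_poly_eq0 (E : seq nat) (p : {poly K}) :
    (forall e, e \notin E -> p`_e = 0) -> ('X - 1) ^+ size E %| p -> p = 0.
Proof.
elim: E p => [|e0 E IH] p supp_p.
  by move=> _; apply/polyP=> e; rewrite coef0 supp_p.
move=> dvd_p; pose q := 'X * p^`() - e0%:R *: p.
have qE e : q`_e = (e%:R - e0%:R) * p`_e.
  rewrite coefB coefZ coefXM mulrBl; case: e => [|e] /=; first by rewrite mul0r.
  by rewrite coef_deriv !mulr_natl.
have q0 : q = 0.
  apply: IH => [e eE|].
    rewrite qE; have [->|ne] := eqVneq e e0; first by rewrite subrr mul0r.
    by rewrite supp_p ?mulr0 // inE negb_or ne.
  have [g pE] := dvdpP _ _ dvd_p.
  apply: dvdp_sub; last by rewrite pE scalerAl /= exprS dvdp_mull // dvdp_mull.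
  apply: dvdp_mull; rewrite pE derivM; apply: dvdp_add.
    by rewrite /= exprS dvdp_mull // dvdp_mull.
  rewrite deriv_exp /= derivB derivX -polyC1 derivC subr0 mul1r polyC1.
  by rewrite -mulr_natr mulrA mulrC mulrA dvdp_mull.
have p0 e : e != e0 -> p`_e = 0.
  move=> ne; have /eqP := qE e; rewrite q0 coef0 eq_sym mulf_eq0 subr_eq0.
  by rewrite (inj_eq natr_inj_pchar0) (negbTE ne) => /eqP.
have pE : p = p`_e0 *: 'X^e0.
  apply/polyP=> e; rewrite coefZ coefXn.
  by have [->|/p0 ->] := eqVneq e e0; rewrite (mulr1, mulr0).
suff p1 : p`_e0 = 0 by rewrite pE p1 scale0r.
have /dvdpP[g gE] : 'X - 1 %| p by apply: dvdp_trans dvd_p; rewrite exprS dvdp_mulr.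
have := congr1 (horner^~ 1) pE.
by rewrite /= {1}gE !hornerE /= expr1n subrr mulr0 mulr1.
Qed.

(* Prescribing the jet of order |E| at u = 0 of a combination of the powers
   (1 + u)^e, e in E, is a square linear system. *)
Lemma sparse_jets (E : seq nat) (h : {poly K}) : uniq E ->
  exists a : nat -> K, 'X^(size E) %|
    \sum_(e <- E) a e *: (1 + 'X) ^+ e - h.
Proof.
move=> uniqE; set k := size E.
pose T : 'M[K]_k := \matrix_(i, j) ((1 + 'X) ^+ nth 0%N E i)`_j.
have Tfree : row_free T.
  rewrite -kermx_eq0; apply/eqP/row_matrixP => i; rewrite row0.
  set v := row i _; have vT : v *m T = 0.
    by apply/sub_kermxP; rewrite /v row_sub.
  (* A left kernel vector of [T] is a combination of the powers [(1 + u)^e] vanishing to order [k]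
     at [u = 0]; writing [x] for [1 + u] makes it a fewnomial vanishing at 1. *)
  pose p : {poly K} := \sum_(i < k) v 0 i *: 'X^(nth 0%N E i).
  have coefp (j : 'I_k) : p`_(nth 0%N E j) = v 0 j.
    rewrite coef_sum (bigD1 j) //= coefZ coefXn eqxx mulr1 big1 ?addr0 // => l lj.
    by rewrite coefZ coefXn nth_uniq // eq_sym (negbTE (lj : (l : nat) != j)) mulr0.
  have p0 : p = 0.
    apply: (@sparse_poly_eq0 E) => [e eE|].
      rewrite coef_sum big1 // => j _; rewrite coefZ coefXn.
      case: eqP eE => [->|_]; last by rewrite mulr0.
      by rewrite mem_nth.
    have pX : 'X^k %| p \Po (1 + 'X).
      apply/dvdp_Xn_coef => j jk; have := congr1 (fun w : 'rV_k => w 0 (Ordinal jk)) vT.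
      rewrite !mxE => vTj; rewrite -[RHS]vTj /p linear_sum /= coef_sum; apply: eq_bigr => l _.
      by rewrite linearZ /= rmorphXn /= comp_polyX coefZ !mxE.
    have := dvdp_comp_poly ('X - 1) pX.
    by rewrite rmorphXn /= comp_polyX -comp_polyA comp_polyD
      rmorph1 comp_polyX [1 + _]addrC subrK comp_polyXr.
  by apply/rowP => j; rewrite -coefp p0 coef0 mxE.
pose w := (\row_(j < k) h`_j) *m invmx T.
have wT : w *m T = \row_(j < k) h`_j by rewrite mulmxKV // -row_free_unit.
exists (fun e => oapp (fun i => w 0 i) 0 (insub (index e E))).
apply/dvdp_Xn_coef => j jk; apply/eqP; rewrite coefB subr_eq0; apply/eqP.
have /(congr1 (fun v : 'rV_k => v 0 (Ordinal jk))) := wT; rewrite !mxE => wj; rewrite -[RHS]wj.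
rewrite coef_sum (big_nth 0%N) big_mkord; apply: eq_bigr => i _.
by rewrite coefZ index_uniq // valK /= !mxE.
Qed.

End Fewnomials.

(** * Restriction to the curves [y = (1 + u)^d] *)

Section PlaneCurves.

Variable K : fieldType.
Hypothesis charK : [pchar K] =i pred0.

Implicit Types (f g : {poly {poly K}}) (t d n r M : nat).

(* The coefficient of u^i y^j in f : {poly {poly K}} is f`_j`_i. *)
Definition tdeg_le t f := forall i j, (t < i + j)%N -> f`_j`_i = 0.

(* The exponents of x in the monomials x^i y^j, i + j <= t, restricted to y = x^d;
   those with i < d give them all, each once. *)
Definition curve_exps d t : seq nat :=
  [seq (i + d * j)%N | i <- iota 0 d, j <- iota 0 (t.+1 - i)].

Lemma curve_exps_uniq d t : uniq (curve_exps d t).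
Proof.
apply: allpairs_uniq_dep; [exact: iota_uniq | by move=> i _; exact: iota_uniq |].
move=> _ _ /allpairsPdep[i [j [+ _ ->]]] /allpairsPdep[i' [j' [+ _ ->]]] /=.
rewrite !mem_iota /= !add0n => id i'd /eqP.
have d_gt0 : (0 < d)%N by lia.
move=> /eqP E; have ii' : i = i'.
  by have := congr1 (modn^~ d) E; rewrite ![(_ + d * _)%N]addnC
    ![(d * _)%N]mulnC !modnMDl !modn_small.
rewrite -ii' in E *; congr (Tagged _ _); apply/eqP.
by rewrite -(eqn_pmul2l d_gt0); apply/eqP; lia.
Qed.

Lemma size_curve_exps d t : size (curve_exps d t) = (\sum_(i < d) (t.+1 - i))%N.
Proof.
rewrite size_allpairs_dep sumnE big_map -(big_mkord xpredT (fun i => t.+1 - i)%N).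
by rewrite /index_iota subn0; apply: eq_bigr => i _; rewrite size_iota.
Qed.

(** Euclidean division [i = s + d q] replaces [x^i y^j] by [x^s y^(j + q)] on the curve, without
    raising the total degree. *)
Lemma mem_curve_exps d t i j :
  (0 < d)%N -> (i + j <= t)%N -> (i + d * j)%N \in curve_exps d t.
Proof.
move=> d_gt0 ijt; have := divn_eq i d; have := ltn_pmod i d_gt0.
move: (i %/ d)%N (i %% d)%N => q s sd iE.
apply/allpairsPdep; exists s, (j + q)%N; rewrite !mem_iota; split; nia.
Qed.

(** Substituting [u = x - 1] preserves degrees in the inner variable, so only restrictions of
    monomials [x^i y^j] with [i + j <= t] occur. *)
Lemma curve_restr_supp d t f e : (0 < d)%N -> tdeg_le t f ->
  e \notin curve_exps d t -> (f.[(1 + 'X) ^+ d] \Po ('X - 1))`_e = 0.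
Proof.
move=> d_gt0 ft eE; rewrite horner_coef linear_sum /= coef_sum big1 // => j _.
rewrite rmorphM /= !rmorphXn /= rmorphD rmorph1 /= comp_polyX [1 + _]addrC subrK.
rewrite -exprM coefMXn; case: ltnP => // de.
have [ijt|ijt] := leqP (e - d * j + j) t.
  by have := mem_curve_exps d_gt0 ijt; rewrite subnK // (negbTE eE).
have szX : size ('X - 1 : {poly K}) = 2 by rewrite -polyC1 size_XsubC.
apply: nth_default; rewrite (size_comp_poly2 _ szX).
by apply/leq_sizeP => i ij; apply: ft; lia.
Qed.

Lemma curve_restr_eq0 d t f : (0 < d)%N -> tdeg_le t f ->
  'X^(\sum_(i < d) (t.+1 - i)) %| f.[(1 + 'X) ^+ d] -> f.[(1 + 'X) ^+ d] = 0.
Proof.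
move=> d_gt0 ft; rewrite -size_curve_exps => /(dvdp_comp_poly ('X - 1)).
rewrite rmorphXn /= comp_polyX => /(sparse_poly_eq0 charK).
move=> /(_ (fun e => curve_restr_supp d_gt0 ft))/(congr1 (comp_poly ('X + 1))).
by rewrite comp_poly0 -comp_polyA comp_polyB rmorph1 comp_polyX addrK comp_polyXr.
Qed.

(** Comparing coefficients of [y^j] gives [g_j c = g_(j-1) - f_j], which bounds the degree of [g_j]
    by induction on [j]. Unlike a bound by the truncated [t - d], the conclusion forces [g = 0] when
    [t < d]. *)
Lemma tdeg_factor t f g (c : {poly K}) d : size c = d.+1 -> (0 < d)%N ->
  tdeg_le t f -> f = g * ('X - c%:P) ->
  forall i j, g`_j`_i != 0 -> (i + j + d <= t)%N.
Proof.
move=> sz_c d_gt0 ft fE.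
have fj j : f`_j = (if j is j'.+1 then g`_j' else 0) - g`_j * c.
  by rewrite fE mulrBr coefB coefMC coefMX; case: j.
have szf j : (j <= t)%N -> (size (f`_j)%R <= t.+1 - j)%N.
  by move=> jt; apply/leq_sizeP => i ij; apply: ft; lia.
have szf0 j : (t < j)%N -> f`_j = 0.
  by move=> jt; apply/polyP => i; rewrite coef0 ft // ltn_addl.
have szgc j : g`_j != 0 -> size (g`_j * c) = (size (g`_j)%R + d)%N.
  move=> gj; rewrite size_mul ?sz_c ?addnS //.
  by rewrite -size_poly_gt0 sz_c.
have key j : g`_j != 0 -> (size (g`_j)%R + j + d <= t.+1)%N.
  elim: j => [|j IH] gj.
    have /(congr1 (fun p : {poly K} => size p)) := fj 0%N.
    rewrite sub0r size_polyN szgc // addn0 => <-.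
    by have := szf 0%N isT; rewrite subn0.
  have gcE : g`_j.+1 * c = g`_j - f`_j.+1 by rewrite fj opprB addrC subrK.
  have := szgc _ gj; rewrite gcE => sz_eq.
  have := size_polyD g`_j (- f`_j.+1); rewrite sz_eq size_polyN.
  have g1 : (0 < size (g`_j.+1)%R)%N by rewrite size_poly_gt0.
  have szg : (size (g`_j)%R <= t.+1 - j - d)%N.
    by have [->|/IH] := eqVneq g`_j 0; [rewrite size_poly0 | lia].
  have szf1 : (size (f`_j.+1)%R <= t - j)%N.
    have [jt|jt] := leqP j.+1 t; first by have := szf _ jt; lia.
    by rewrite szf0 // size_poly0.
  rewrite leq_max; move: szg szf1 g1 d_gt0; move: (size _) (size _) (size _) => a b e.
  by move=> ? ? ? ? /orP[]; lia.
move=> i j gji; have gj : g`_j != 0 by apply: contraNneq gji => ->; rewrite coef0.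
have := key j gj; have : (i < size (g`_j)%R)%N.
  by rewrite ltnNge; apply: contraNN gji => /leq_sizeP/(_ i (leqnn i)) ->.
lia.
Qed.

End PlaneCurves.

(** * The monomial valuation of weights (1, n) *)

Section Valuation.

Variable K : fieldType.
Hypothesis charK : [pchar K] =i pred0.

Implicit Types (f g F G : {poly {poly K}}) (t d n r M : nat).

Lemma sum_subn_small d T :
  (d <= T.+1)%N -> (2 * (\sum_(i < d) (T - i)) + d * d = 2 * d * T + d)%N.
Proof.
elim: d => [|d IH] dT; first by rewrite big_ord0.
rewrite big_ord_recr /= mulnDr; have := IH (ltnW dT); have : T = (d + (T - d))%N by lia.
by move: (T - d)%N (\sum_(i < d) _)%N => e S; nia.
Qed.

Lemma sum_subn_ge d T : (2 * d * T + d <= 2 * (\sum_(i < d) (T - i)) + d * d)%N.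
Proof.
elim: d => [|d IH]; first by rewrite big_ord0.
rewrite big_ord_recr /= mulnDr; move: IH; have : (T <= d + (T - d))%N by lia.
move: (T - d)%N (\sum_(i < d) _)%N => e S; nia.
Qed.

Lemma sum_subn_large d T :
  (T <= d)%N -> (2 * (\sum_(i < d) (T - i)) = T * T.+1)%N.
Proof.
move=> Td; rewrite -(subnKC Td); elim: (d - T)%N => [|e IH].
  by rewrite addn0; have := @sum_subn_small T T (leqnSn T); nia.
by rewrite addnS big_ord_recr /= mulnDr IH; lia.
Qed.

(* The monomial valuation giving weight 1 to the inner variable u and n to the
   outer variable v: its ideal of level n m is the limit of the ideals of n points
   of multiplicity m moving along v = 0 to the origin. *)
Definition val_ge n M F := forall a b, (a + n * b < M)%N -> F`_b`_a = 0.

(** As [r < n], the factor [v - u^r] has weight [r]. The product expresses the coefficient of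
    [u^a v^b] in [G] through that of [u^(a + r) v^(b - 1)], whose weight is smaller. *)
Lemma val_ge_quot n r M G : (r < n)%N ->
  val_ge n M (G * ('X - ('X^r)%:P)) -> val_ge n (M - r) G.
Proof.
move=> rn FM a b; elim/ltn_ind: {a b}(a + n * b)%N {-2}a {-2}b (erefl (a + n * b)%N).
move=> w IH a b wE.
have rec : G`_b`_a = (if b is b'.+1 then G`_b' else 0 : {poly K})`_(a + r)
             - (G * ('X - ('X^r)%:P))`_b`_(a + r).
  rewrite mulrBr !coefB coefMC coefMX coefMXn ltnNge leq_addl addnK /=.
  by case: b {IH wE} => [|b]; rewrite opprB addrC subrK.
move=> wM; rewrite rec (FM (a + r)%N) ?subr0; last by lia.
case: b IH wE wM {rec} => [|b] IH wE wM; first by rewrite coef0.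
by apply: (IH (a + r + n * b)%N) => //; rewrite ?wE; move: wE wM; rewrite mulnS; lia.
Qed.

Lemma val_ge_restr n r M rho F :
    (forall a b, (M <= a + n * b)%N -> (rho <= a + r * b)%N) ->
  val_ge n M F -> 'X^rho %| F.['X^r].
Proof.
move=> le_rho FM; rewrite horner_coef; apply: (big_ind (fun p => 'X^rho %| p)).
- exact: dvdp0.
- exact: dvdp_add.
move=> b _; apply/dvdp_Xn_coef => a a_rho; rewrite -exprM coefMXn; case: ltnP => // rba.
by apply: FM; rewrite ltnNge; apply/negP => /le_rho; lia.
Qed.

(* The curve y = (1 + u)^d meets the graph y = psi(u) at u = 0 with multiplicity
   exactly r. *)
Definition contact_graph d r : {poly K} := (1 + 'X) ^+ d - 'X^r.

(** In the coordinate [v = y - psi(u)] the curve [y = (1 + u)^d] is [v = u^r]. The last hypothesis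
    makes the order of the restriction reach its number of exponents, so the restriction is zero. *)
Lemma degenerate_factor d r n M t f : (0 < d)%N -> (r < n)%N ->
    tdeg_le t f -> val_ge n M (f \Po ('X + (contact_graph d r)%:P)) ->
    (forall a b, (M <= a + n * b)%N -> (\sum_(i < d) (t.+1 - i) <= a + r * b)%N) ->
  exists g, [/\ f = g * ('X - ((1 + 'X) ^+ d)%:P),
    (forall i j, g`_j`_i != 0 -> (i + j + d <= t)%N) &
    val_ge n (M - r) (g \Po ('X + (contact_graph d r)%:P))].
Proof.
move=> d_gt0 rn ft fM le_M; pose c : {poly K} := (1 + 'X) ^+ d.
have fcE : f.[c] = (f \Po ('X + (contact_graph d r)%:P)).['X^r].
  by rewrite horner_comp hornerD hornerX hornerC ['X^r + _]addrC subrK.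
have /eqP/factor_theorem[g fE] : f.[c] = 0.
  apply: (curve_restr_eq0 charK d_gt0 ft); rewrite -/c fcE.
  exact: val_ge_restr le_M fM.
have sz_c : size c = d.+1.
  by rewrite /c -[1]opprK addrC -polyC1 -polyCN size_exp_XsubC.
exists g; split=> //; first exact: tdeg_factor sz_c d_gt0 ft fE.
apply: val_ge_quot => //; move: fM.
rewrite fE comp_polyM comp_polyB comp_polyX comp_polyC polyCB.
by rewrite -/c addrA addrAC addrK.
Qed.

(* With n = sigma^2, d = sigma - 1 and r = sigma d, each division by
   y - (1 + u)^d lowers the degree by d and the valuation by r.  What is left after
   the last step are x sigma simple conditions in degree s + x < d. *)
Lemma degenerate_eq0 (s x d q : nat) f :
    let sigma := d.+1 in
    let r := (sigma * d)%N in
    (2 * s + 4 <= sigma)%N -> (s + x + 2 <= sigma)%N ->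
    ((s + x).+1 * (s + x).+2 <= 2 * (x * sigma))%N ->
    tdeg_le (s + x + q * d) f ->
    val_ge (sigma ^ 2) (x * sigma + q * r) (f \Po ('X + (contact_graph d r)%:P)) ->
  f = 0.
Proof.
move=> sigma r s_le sx_le x_ge.
have d_gt0 : (0 < d)%N by lia.
have rn : (r < sigma ^ 2)%N by rewrite /r expnS expn1 ltn_pmul2l.
elim: q f => [|q IH] f ft fM.
  have [|g [-> g_t _]] := degenerate_factor d_gt0 rn ft fM.
    move=> a b; have : ((s + x).+1 <= d)%N by lia.
    rewrite mul0n !addn0 => /sum_subn_large.
    move: (\sum_(i < d) _)%N => S SE Mab.
    (* [S] is a triangular number since [s + x < d]. If [b = 0] then [a >= x sigma]; if [b > 0] then
       [r b >= sigma d >= x sigma]. *)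
    have Sx : (S <= x * sigma)%N by lia.
    apply: leq_trans Sx _; case: b Mab => [|b]; first by rewrite !muln0.
    move=> _; rewrite mulnS addnCA /r mulnC; apply: leq_trans (leq_addr _ _).
    by rewrite leq_mul2l; apply/orP; right; lia.
  (* A nonzero quotient would have degree at most [s + x - d < 0]. *)
  rewrite [g](_ : _ = 0) ?mul0r //; apply/polyP => j; apply/polyP => i.
  by rewrite !coef0; apply/eqP/negPn/negP => /g_t; lia.
have [|g [-> g_t gM]] := degenerate_factor d_gt0 rn ft fM.
  move=> a b; have : (d <= (s + x + q.+1 * d).+2)%N by rewrite mulSn; lia.
  move=> /sum_subn_small.
  move: (\sum_(i < d) _)%N => S SE Mab.
  (* The valuation is [sigma X]. On either side of [b = X / sigma], the order [a + r b] is at least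
     [d X], its value at [a = 0], [b = X / sigma]. *)
  set X := (x + q.+1 * d)%N.
  have key : (d * X <= a + r * b)%N.
    have {Mab} Mab : (sigma * X <= a + sigma * (sigma * b))%N.
      by rewrite mulnA mulnn /X mulnDr [(sigma * x)%N]mulnC mulnCA.
    have [Xb|/ltnW Xb] := leqP X (sigma * b).
      apply: leq_trans (leq_addl _ _); rewrite /r [(sigma * d)%N]mulnC -mulnA.
      by rewrite leq_mul2l Xb orbT.
    rewrite /r -mulnA mulnCA.
    move: Mab Xb; rewrite /sigma; move: (d.+1 * b)%N => Y.
    by rewrite !mulSn; lia.
  (* The number of exponents is at most [d X] exactly when [2 s + 3 <= d]. *)
  have ds : (d * (2 * s + 3) <= d * d)%N by rewrite leq_mul2l; apply/orP; right; lia.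
  have E : (d * (s + x + q.+1 * d) = d * s + d * X)%N by rewrite /X -mulnDr addnA.
  have {}SE : (2 * S + d * d = 2 * (d * s + d * X) + 2 * d + d)%N.
    by rewrite SE -E; lia.
  move: ds; rewrite mulnDr mulnCA; lia.
rewrite (IH g) ?mul0r //.
  move=> i j; apply: contraTeq => /g_t; rewrite mulSn; lia.
by have := gM; rewrite mulSn addnCA [X in (X - _)%N]addnC addnK.
Qed.

End Valuation.

(** * Prescribing jets along [y = (1 + u)^sigma] *)

Section Jets.

Variable K : fieldType.
Hypothesis charK : [pchar K] =i pred0.

Lemma curve_exps_div d t e : e \in curve_exps d t -> (e %% d + e %/ d <= t)%N.
Proof.
move=> /allpairsPdep[i [j []]]; rewrite !mem_iota !add0n /= => id ji ->.
have d_gt0 : (0 < d)%N by lia.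
rewrite ![(i + _)%N]addnC [(d * j)%N]mulnC modnMDl divnMDl // modn_small // divn_small //; lia.
Qed.

(** Induction on [m]. The coefficient of [v^0] is the restriction to the curve, prescribed by [f0];
    a multiple of [v = y - (1 + u)^sigma] leaves it unchanged and settles the rows [b > 0], with [m]
    lowered by 1 and the degree by [sigma]. *)
Lemma curve_jets (sigma s m : nat) (h : nat -> {poly K}) :
    (0 < sigma)%N -> (sigma <= 2 * s + 3)%N ->
  exists2 f : {poly {poly K}}, tdeg_le (m * sigma + s) f &
    forall b a, (a + sigma ^ 2 * b < sigma ^ 2 * m)%N ->
      (f \Po ('X + ((1 + 'X) ^+ sigma)%:P))`_b`_a = (h b)`_a.
Proof.
move=> sigma_gt0 s_ge; elim: m h => [|m IH] h.
  by exists 0 => [i j _|b a]; [rewrite !coef0 | rewrite muln0].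
set t := (m.+1 * sigma + s)%N; set c : {poly K} := (1 + 'X) ^+ sigma.
(* There are enough exponents because [sigma (2 s + 3 - sigma) >= 0]; exactly as many as there are
   conditions on the restriction are kept. *)
pose E := take (sigma ^ 2 * m.+1) (curve_exps sigma t).
have szE : size E = (sigma ^ 2 * m.+1)%N.
  rewrite size_takel // size_curve_exps.
  have := sum_subn_ge sigma t.+1; move: (\sum_(i < sigma) _)%N => S.
  have : (sigma * sigma <= sigma * (2 * s + 3))%N by rewrite leq_mul2l s_ge orbT.
  rewrite /t -mulnn; move: (mulnA sigma sigma m.+1) (mulnC m.+1 sigma).
  move: (m.+1 * sigma)%N => y.
  rewrite -!mulnA !mulnDr; move: (sigma * y)%N; nia.
have [a aE] := sparse_jets charK (h 0%N)
  (take_uniq (sigma ^ 2 * m.+1) (curve_exps_uniq sigma t)).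
pose f0 : {poly {poly K}} :=
  \sum_(e <- E) (a e *: (1 + 'X) ^+ (e %% sigma))%:P * 'X^(e %/ sigma).
have f0_t : tdeg_le t f0.
  move=> i j ijt; rewrite /f0 coef_sum coef_sum big_seq big1 // => e /mem_take eE.
  rewrite coefCM coefXn; case: eqP => [jE|_]; last by rewrite mulr0 coef0.
  rewrite mulr1 coefZ [X in _ * X]nth_default ?mulr0 //.
  rewrite -[1]opprK addrC -polyC1 -polyCN size_exp_XsubC.
  by have := curve_exps_div eE; lia.
have f0c : f0.[c] = \sum_(e <- E) a e *: (1 + 'X) ^+ e.
  rewrite /f0 horner_sum; apply: eq_bigr => e _.
  by rewrite hornerM hornerC hornerXn -exprM -scalerAl -exprD addnC mulnC -divn_eq.
pose F0 := f0 \Po ('X + c%:P).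
(* Multiplication by [v] shifts the rows by one; what [f0] contributes to them is removed first. *)
have [f1 f1_t f1E] := IH (fun b => h b.+1 - F0`_b.+1).
exists (f0 + f1 * ('X - c%:P)) => [i j ijt|b u ub].
  rewrite coefD coefD f0_t // add0r mulrBr coefB coefMC coefMX coefB coefM.
  rewrite big1 => [|[l li] _ /=]; last first.
    have [il|il] := leqP (i - l) sigma; first by rewrite f1_t ?mul0r //; lia.
    rewrite mulrC nth_default ?mul0r //.
    by rewrite /c -[1]opprK addrC -polyC1 -polyCN size_exp_XsubC.
  rewrite subr0; case: j ijt => [|j] ijt; first by rewrite coef0.
  by rewrite f1_t //; lia.
rewrite comp_polyD comp_polyM comp_polyB comp_polyX comp_polyC addrK -/F0 coefD coefMX coefD.
case: b ub => [|b] ub /=.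
  rewrite coef0 addr0 -horner_coef0 horner_comp hornerD hornerX hornerC add0r f0c.
  apply/eqP; rewrite -subr_eq0 -coefB; apply/eqP; move/dvdp_Xn_coef: aE; apply.
  by rewrite szE; lia.
by rewrite f1E ?coefB; [rewrite addrC subrK | move: ub; rewrite !mulnS; lia].
Qed.

End Jets.

(** * Ranks of families of linear forms *)

Lemma poly_nonroot (K : fieldType) (p : {poly K}) :
  [pchar K] =i pred0 -> p != 0 -> exists e, p.[e] != 0.
Proof.
move=> charK p0; pose s := [seq k%:R : K | k <- iota 0 (size p)].
have uniq_s : uniq s by rewrite map_inj_uniq ?iota_uniq //; exact: natr_inj_pchar0.
have /allPn[e _ ne] : ~~ all (root p) s.
  by apply/negP => rts; have := max_poly_roots p0 rts uniq_s; rewrite size_map size_iota ltnn.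
by exists e; rewrite -rootE.
Qed.

Section FamilyRank.

Variable K : fieldType.

(** The determinant of [B *m colsub f A] is polynomial in the entries of [A]; it equals 1 here and
    certifies rank at least [r] wherever it does not vanish. *)
Lemma rank_minor p q r (A : 'M[K]_(p, q)) : r = \rank A ->
  exists (f : 'I_r -> 'I_q) (B : 'M_(r, p)), B *m colsub f A = 1%:M.
Proof.
rewrite -mxrank_tr => ->; exists (maxrankfun A^T).
have : row_full (colsub (maxrankfun A^T) A).
  rewrite /row_full -mxrank_tr (_ : _^T = rowsub (maxrankfun A^T) A^T); last
    by apply/matrixP => i j; rewrite !mxE.
  exact: (maxrowsub_free A^T).
by move/row_fullP=> [B BA]; exists B.
Qed.

Lemma rank_ge_minor p q r (A : 'M[K]_(p, q)) (f : 'I_r -> 'I_q) (B : 'M_(r, p)) :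
  \det (B *m colsub f A) != 0 -> (r <= \rank A)%N.
Proof.
rewrite -unitfE -unitmxE => /mxrank_unit {1}<-.
apply: leq_trans (mxrankM_maxr _ _) _.
have -> : colsub f A = A *m colsub f 1%:M by rewrite mulmx_colsub mulmx1.
exact: mxrankM_maxl.
Qed.

Variables I J : finType.

Definition family_mx (R : Type) (A : I -> J -> R) : 'M[R]_(#|I|, #|J|) :=
  \matrix_(i, j) A (enum_val i) (enum_val j).

(** Rows stand for the coefficients of a polynomial, columns for linear conditions on it: rank
    [#|I|] means that only 0 satisfies them, rank [#|J|] that they are independent. *)
Definition family_rank (A : I -> J -> K) : nat := \rank (family_mx A).

Lemma mul_family_mx (v : 'rV[K]_#|I|) (A : I -> J -> K) j :
  (v *m family_mx A) 0 (enum_rank j) = \sum_i v 0 (enum_rank i) * A i j.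
Proof.
rewrite mxE (reindex enum_rank) /=; last exact/onW_bij/enum_rank_bij.
by apply: eq_bigr => i _; rewrite mxE !enum_rankK.
Qed.

Lemma family_rank_le_rows A : (family_rank A <= #|I|)%N.
Proof. exact: rank_leq_row. Qed.

Lemma family_rank_le_cols A : (family_rank A <= #|J|)%N.
Proof. exact: rank_leq_col. Qed.

Lemma family_rank_free A :
  (forall c : I -> K, (forall j, \sum_i c i * A i j = 0) -> forall i, c i = 0) <->
  family_rank A = #|I|.
Proof.
split=> [free|rk c cA i].
  apply/eqP; rewrite -[_ == _]/(row_free _) -kermx_eq0; apply/eqP/row_matrixP => i.
  rewrite row0; set v := row i _; have vA : v *m family_mx A = 0.
    by apply/sub_kermxP; rewrite /v row_sub.
  apply/rowP => j; rewrite [RHS]mxE -(enum_valK j).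
  apply: (free (fun i => v 0 (enum_rank i))) => k.
  by rewrite -mul_family_mx vA mxE.
have /row_freeP[B AB] : row_free (family_mx A) by apply/eqP.
pose v : 'rV_#|I| := \row_k c (enum_val k).
have vA : v *m family_mx A = 0.
  apply/rowP => j; rewrite -(enum_valK j) mul_family_mx mxE -[RHS](cA (enum_val j)).
  by apply: eq_bigr => k _; rewrite mxE enum_rankK.
have : v *m (family_mx A *m B) = 0 by rewrite mulmxA vA mul0mx.
by rewrite AB mulmx1 => /rowP/(_ (enum_rank i)); rewrite !mxE enum_rankK.
Qed.

Lemma family_rank_full A :
  (forall h : J -> K, exists c : I -> K, forall j, \sum_i c i * A i j = h j) <->
  family_rank A = #|J|.
Proof.
split=> [full|rk h].
  apply/eqP; rewrite -[_ == _]/(row_full _) -sub1mx; apply/row_subP => i.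
  have [c cE] := full (fun j => (row i 1%:M : 'rV_#|J|) 0 (enum_rank j)).
  apply/submxP; exists (\row_k c (enum_val k)); apply/rowP => j.
  rewrite -(enum_valK j) mul_family_mx -cE.
  by apply: eq_bigr => k _; rewrite mxE enum_rankK.
have /row_fullP[B BA] : row_full (family_mx A) by apply/eqP.
pose w : 'rV_#|J| := \row_k h (enum_val k).
exists (fun i => (w *m B) 0 (enum_rank i)) => j.
by rewrite -mul_family_mx -mulmxA BA mulmx1 mxE enum_rankK.
Qed.

Lemma family_rank_specialize (A : I -> J -> {poly K}) : [pchar K] =i pred0 ->
  exists2 e : K, e != 0 &
    (family_rank (fun i j => (A i j).[0]) <= family_rank (fun i j => (A i j).[e]))%N.
Proof.
move=> charK; set A0 := fun i j => (A i j).[0].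
have [f [B BA]] := rank_minor (erefl (family_rank A0)).
pose D : {poly K} := \det (map_mx polyC B *m colsub f (family_mx A)).
have DE e : D.[e] = \det (B *m colsub f (family_mx (fun i j => (A i j).[e]))).
  rewrite -[LHS]/(horner_eval e D) -det_map_mx map_mxM -map_mx_comp.
  congr (\det (_ *m _)); first by apply/matrixP => i j; rewrite !mxE /= /horner_eval hornerC.
  by apply/matrixP => i j; rewrite !mxE.
(* The factor ['X] excludes the parameter 0. *)
have D0 : 'X * D != 0.
  rewrite mulf_neq0 ?polyX_eq0 //; apply: contra_eq_neq (DE 0) => ->.
  by rewrite horner0 BA det1 eq_sym oner_eq0.
have [e ne] := poly_nonroot charK D0.
move: ne; rewrite hornerM hornerX mulf_eq0 negb_or => /andP[e0 De].
by exists e => //; apply: (@rank_ge_minor _ _ _ _ f B); rewrite -DE.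
Qed.

End FamilyRank.

(** Rank and nullity add up to [#|I|] for both families, whose sets of conditions may differ. *)
Lemma family_rank_le (K : fieldType) (I J J' : finType) (A : I -> J -> K)
    (B : I -> J' -> K) :
    (forall c : I -> K, (forall j, \sum_i c i * B i j = 0) ->
       forall j, \sum_i c i * A i j = 0) ->
  (family_rank A <= family_rank B)%N.
Proof.
move=> BA; have kerBA : (kermx (family_mx B) <= kermx (family_mx A))%MS.
  apply/row_subP => i; set v := row i _; have vB : v *m family_mx B = 0.
    by apply/sub_kermxP; rewrite /v row_sub.
  apply/sub_kermxP/rowP => j; rewrite -(enum_valK j) mul_family_mx [RHS]mxE.
  by apply: (BA (fun i => v 0 (enum_rank i))) => k; rewrite -mul_family_mx vB mxE.
have := mxrankS kerBA; rewrite !mxrank_ker /family_rank.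
have := rank_leq_row (family_mx A); have := rank_leq_row (family_mx B); lia.
Qed.

(** * Degeneration of points along a graph *)

(** It indexes both the monomials of degree less than [s] and the jet coefficients that vanish at a
    point of multiplicity [s]. *)
Definition tri (s : nat) : finType := {p : 'I_s * 'I_s | (p.1 + p.2 < s)%N}.

Lemma tri_lt s (p : tri s) : ((val p).1 + (val p).2 < s)%N.
Proof. exact: (valP p). Qed.

Lemma coef_XaddC_exp (R : comNzRingType) (c : R) l b :
  (('X + c%:P) ^+ l)`_b = c ^+ (l - b) *+ 'C(l, b).
Proof.
rewrite addrC exprDn coef_sum.
under eq_bigr => i _ do rewrite coefMn -polyC_exp coefCM coefXn.
have [bl|lb] := ltnP b l.+1.
  rewrite (bigD1 (Ordinal bl)) //= eqxx mulr1 big1 ?addr0 // => i ib.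
  by rewrite eq_sym (negbTE (ib : (i : nat) != b)) mulr0 mul0rn.
rewrite bin_small // mulr0n big1 // => i _.
by rewrite gtn_eqF ?mulr0 ?mul0rn //; apply: leq_trans (ltn_ord i) lb.
Qed.

Section Degeneration.

Variable K : fieldType.
Hypothesis charK : [pchar K] =i pred0.

Implicit Types (f : {poly {poly K}}) (psi : {poly K}).

Definition mono2 (k l : nat) : {poly {poly K}} := ('X^k)%:P * 'X^l.

Definition bipoly s (c : tri s -> K) : {poly {poly K}} :=
  \sum_p (c p)%:P%:P * mono2 (val p).1 (val p).2.

Definition taylor (x y : K) f : {poly {poly K}} :=
  map_poly (comp_poly ('X + x%:P)) f \Po ('X + y%:P%:P).

(** The coefficient of [u^a v^b] in [(u + x)^k (v + y)^l]; where a subtraction truncates, a binomial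
    coefficient is 0. *)
Definition jet_coef (x y : K) (k l a b : nat) : K :=
  ('C(k, a) * 'C(l, b))%:R * (x ^+ (k - a) * y ^+ (l - b)).

Lemma taylor_mono2 x y k l a b : (taylor x y (mono2 k l))`_b`_a = jet_coef x y k l a b.
Proof.
rewrite /taylor /mono2 rmorphM /= map_polyC map_polyXn comp_polyM comp_polyC.
rewrite coefCM !rmorphXn /= !comp_polyX.
transitivity (nth 0 (('X + x%:P) ^+ k * (y%:P ^+ (l - b) *+ 'C(l, b))) a).
  congr (nth _ (polyseq (_ * _)) _); first by rewrite rmorphXn /= comp_polyX.
  exact: coef_XaddC_exp.
rewrite -polyC_exp -polyCMn coefMC coef_XaddC_exp /jet_coef.
by rewrite natrM -[X in X * _ = _]mulr_natr -[X in _ * X = _]mulr_natr mulrACA mulrC.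
Qed.

Lemma coef_rmorph_bipoly s (c : tri s -> K)
    (phi : {rmorphism {poly {poly K}} -> {poly {poly K}}}) a b :
    (forall k : K, phi k%:P%:P = k%:P%:P) ->
  (phi (bipoly c))`_b`_a =
  \sum_p c p * (phi (mono2 (val p).1 (val p).2))`_b`_a.
Proof.
move=> phiC; rewrite /bipoly rmorph_sum /= !coef_sum; apply: eq_bigr => p _.
by rewrite rmorphM phiC !coefCM.
Qed.

Lemma coef_taylor_bipoly s (c : tri s -> K) x y a b :
  (taylor x y (bipoly c))`_b`_a =
  \sum_p c p * jet_coef x y (val p).1 (val p).2 a b.
Proof.
rewrite -[taylor x y _]/((comp_poly _ \o map_poly _) _) coef_rmorph_bipoly.
  by apply: eq_bigr => p _; rewrite -taylor_mono2.
by move=> k; rewrite /= map_polyC /= !comp_polyC.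
Qed.

Definition graph_coef psi b a f : K := (f \Po ('X + psi%:P))`_b`_a.

Lemma graph_coef_bipoly s (c : tri s -> K) psi a b :
  graph_coef psi b a (bipoly c) =
  \sum_p c p * graph_coef psi b a (mono2 (val p).1 (val p).2).
Proof. by rewrite /graph_coef coef_rmorph_bipoly // => k; rewrite /= comp_polyC. Qed.

(** Since [psi(x + u) - psi(x)] is divisible by [u], passing from [y] to [v] at a point of the graph
    keeps the order [m], and the coefficient of [v^b] has order at least [m - b]. *)
Lemma graph_mult f psi x m b :
    (forall a b', (a + b' < m)%N -> (taylor x psi.[x] f)`_b'`_a = 0) ->
  'X^(m - b) %| (f \Po ('X + psi%:P))`_b \Po ('X + x%:P).
Proof.
move=> fm; set S := comp_poly ('X + x%:P).
have psiS : 'X %| S psi - psi.[x]%:P.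
  rewrite -['X]subr0 -polyC0 dvdp_XsubCl rootE hornerD hornerN hornerC.
  by rewrite horner_comp !hornerE subrr.
have FE : map_poly S (f \Po ('X + psi%:P)) =
          taylor x psi.[x] f \Po ('X + (S psi - psi.[x]%:P)%:P).
  rewrite map_comp_poly rmorphD /= map_polyX map_polyC /= /taylor -comp_polyA.
  rewrite comp_polyD comp_polyX comp_polyC -addrA -polyCD.
  by rewrite subrK.
have -> : S (f \Po ('X + psi%:P))`_b = (map_poly S (f \Po ('X + psi%:P)))`_b.
  by rewrite coef_map.
rewrite FE coef_comp_poly; apply: (big_ind (fun p => 'X^(m - b) %| p)).
- exact: dvdp0.
- exact: dvdp_add.
move=> l _; rewrite coef_XaddC_exp; have [lb|bl] := ltnP l b.
  by rewrite bin_small // mulr0n mulr0 dvdp0.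
rewrite mulrnAr -mulr_natr dvdp_mulr //.
have -> : (m - b = (m - l) + (m - b - (m - l)))%N by lia.
rewrite exprD dvdp_mul //.
  by apply/dvdp_Xn_coef => a am; apply: fm; lia.
by apply: dvdp_trans (dvdp_exp2r _ psiS); rewrite dvdp_exp2l //; lia.
Qed.

End Degeneration.

(** * Collision of [n] points of a graph *)

Section LimitOfPoints.

Variable K : fieldType.
Hypothesis charK : [pchar K] =i pred0.

Lemma dvdp_prod_nodes (r : seq nat) e (p : {poly K}) : uniq r ->
    (forall i, i \in r -> ('X - i%:R%:P) ^+ e %| p) ->
  \prod_(i <- r) ('X - i%:R%:P) ^+ e %| p.
Proof.
elim: r => [|i r IH] /=; first by rewrite big_nil dvd1p.
move=> /andP[ir ur] dvd_p; rewrite big_cons Gauss_dvdp.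
  by rewrite dvd_p ?mem_head // IH // => j jr; rewrite dvd_p // inE jr orbT.
rewrite big_seq; apply: (big_ind (coprimep _)) => [|p1 p2 c1 c2|j jr].
- exact: coprimep1.
- by rewrite coprimepMr c1.
apply/coprimep_expl/coprimep_expr; rewrite coprimep_XsubC rootE hornerXsubC subr_eq0.
rewrite (inj_eq (natr_inj_pchar0 charK)).
by apply: contraNneq ir => <-.
Qed.

Section Family.

Variables (n m s : nat).

Definition jet_family (pts : 'I_n -> K * K) (p : tri s) (q : 'I_n * tri m) : K :=
  jet_coef (pts q.1).1 (pts q.1).2 (val p).1 (val p).2 (val q.2).1 (val q.2).2.

(* The conditions of valuation at least n m along the graph of psi: the monomials
   u^(i + n a) v^b with i < n and a + b < m are those of weight less than n m. *)
Definition graph_family (psi : {poly K}) (p : tri s) (q : 'I_n * tri m) : K :=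
  graph_coef psi (val q.2).2 (q.1 + n * (val q.2).1) (mono2 K (val p).1 (val p).2).

(** The points will have abscissas [e i]. Rescaling [u] by [e] moves them to [0, ..., n - 1], where
    the coefficient of [v^b] vanishes to order [m - b]. *)
Definition nodes (b : nat) : {poly K} := \prod_(i <- iota 0 n) ('X - i%:R%:P) ^+ (m - b).

Lemma size_nodes b : size (nodes b) = (n * (m - b)).+1.
Proof.
rewrite /nodes prodrXl -[LHS]prednK; last first.
  by rewrite size_poly_gt0 expf_neq0 // monic_neq0 // monic_prod_XsubC.
by rewrite size_exp size_prod_XsubC /= size_iota.
Qed.

(** For [alpha] below the degree of [nodes b]: at [e = 0] this is the coefficient of [g]; at
    [e != 0] it is, up to the factor [e^alpha], a coefficient of [g(e u)] reduced modulo [nodes b].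
    Terms with [j < alpha] are 0, as ['X^j] is already reduced. *)
Let deform (g : {poly K}) (b alpha : nat) : {poly K} :=
  \sum_(j < size g) (g`_j * ('X^j %% nodes b)`_alpha) *: 'X^(j - alpha).

Let deform0 g b alpha : (alpha < n * (m - b))%N -> (deform g b alpha).[0] = g`_alpha.
Proof.
move=> alpha_lt; rewrite /deform horner_sum.
have small j : (j <= alpha)%N -> 'X^j %% nodes b = 'X^j.
  by move=> ja; rewrite modp_small // size_polyXn size_nodes; lia.
have [ag|ga] := ltnP alpha (size g).
  rewrite (bigD1 (Ordinal ag)) //= small // hornerZ hornerXn subnn expr0 mulr1.
  rewrite coefXn eqxx mulr1 big1 ?addr0 // => j ja; rewrite hornerZ hornerXn.
  have [/small ->|/ltnW aj] := leqP j alpha.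
    by rewrite coefXn eq_sym (negbTE (ja : (j : nat) != alpha)) mulr0 mul0r.
  by rewrite expr0n subn_eq0 leqNgt ltn_neqAle aj eq_sym ja mulr0.
rewrite nth_default // big1 // => j _; rewrite hornerZ hornerXn small ?coefXn.
  by rewrite gtn_eqF ?mulr0 ?mul0r // (leq_trans (ltn_ord j)).
by apply: ltnW; apply: leq_trans (ltn_ord j) ga.
Qed.

Let deform_scale g b alpha e : (alpha < n * (m - b))%N -> e != 0 ->
  e ^+ alpha * (deform g b alpha).[e] = ((g \Po (e *: 'X)) %% nodes b)`_alpha.
Proof.
move=> alpha_lt e0; rewrite /deform horner_sum mulr_sumr comp_polyE.
rewrite (big_morph (fun p => p %% nodes b) (modpD _) (mod0p _)) coef_sum.
apply: eq_bigr => j _; rewrite hornerZ hornerXn modpZl exprZn modpZl !coefZ.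
have [aj|ja] := leqP alpha j; first
  by rewrite (_ : e ^+ j = e ^+ alpha * e ^+ (j - alpha)); [ring | rewrite -exprD subnKC].
rewrite modp_small ?coefXn; last by rewrite size_polyXn size_nodes; lia.
by rewrite gtn_eqF // !mulr0 mul0r mulr0.
Qed.

Lemma tri_alpha_lt (i : 'I_n) (q : tri m) :
  (i + n * (val q).1 < n * (m - (val q).2))%N.
Proof.
have := tri_lt q; have := ltn_ord i; move: (val q).1 (val q).2 => a b.
case: (nat_of_ord i) => [|j]; nia.
Qed.

(** The deformed family has the rank of the graph conditions at parameter 0, hence at least that
    rank at some [e != 0]. There it vanishes on every polynomial with zero jets at the points
    [(e i, psi(e i))]. *)
Lemma graph_family_rank_le psi :
  exists pts, (family_rank (graph_family psi) <= family_rank (jet_family pts))%N.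
Proof.
pose A (p : tri s) (q : 'I_n * tri m) : {poly K} :=
  deform (mono2 K (val p).1 (val p).2 \Po ('X + psi%:P))`_((val q.2).2)
    (val q.2).2 (q.1 + n * (val q.2).1).
have [e e0 rkA] := family_rank_specialize A charK.
exists (fun i => (e *+ i, psi.[e *+ i])).
have -> : family_rank (graph_family psi) = family_rank (fun p q => (A p q).[0]).
  by congr (\rank _); apply/matrixP => i j; rewrite !mxE deform0 // tri_alpha_lt.
apply: leq_trans rkA _; apply: family_rank_le => c cJ [i q].
set b := (val q).2; set alpha := (i + n * (val q).1)%N.
pose F := bipoly c \Po ('X + psi%:P).
have nodesF : nodes b %| F`_b \Po (e *: 'X).
  apply: dvdp_prod_nodes => [|k]; first exact: iota_uniq.
  rewrite mem_iota add0n /= => kn.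
  have /(dvdp_comp_poly (e *: ('X - k%:R%:P))) :
      'X^(m - b) %| F`_b \Po ('X + (e *+ k)%:P).
    apply: graph_mult => a' b' ab'.
    have am : (a' < m)%N by lia. 
    have bm : (b' < m)%N by lia.
    rewrite coef_taylor_bipoly.
    exact: (cJ (Ordinal kn, Sub (Ordinal am, Ordinal bm) ab' : tri m)).
  rewrite -comp_polyA comp_polyD comp_polyX comp_polyC rmorphXn /= comp_polyX.
  rewrite (_ : e *: _ + _ = e *: 'X).
    by rewrite exprZn dvdpZl // expf_neq0.
  by rewrite scalerBr -[e *: k%:R%:P]mul_polyC -polyCM mulr_natr subrK.
have alpha_lt : (alpha < n * (m - b))%N by apply: tri_alpha_lt.
have FbE : F`_b = \sum_p c p *: (mono2 K (val p).1 (val p).2 \Po ('X + psi%:P))`_b.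
  rewrite /F /bipoly linear_sum /= coef_sum; apply: eq_bigr => p _.
  by rewrite comp_polyM comp_polyC coefCM mul_polyC.
apply: (mulfI (expf_neq0 alpha e0)); rewrite mulr0 mulr_sumr.
transitivity (((F`_b \Po (e *: 'X)) %% nodes b)`_alpha); last first.
  by rewrite (modp_eq0 nodesF) coef0.
rewrite FbE linear_sum /= (big_morph (fun p => p %% nodes b) (modpD _) (mod0p _)) coef_sum.
apply: eq_bigr => p _; rewrite comp_polyZ modpZl coefZ -deform_scale //.
by rewrite mulrCA.
Qed.

End Family.

End LimitOfPoints.

Lemma tri_inj s (p q : tri s) :
  (val p).1 = (val q).1 :> nat -> (val p).2 = (val q).2 :> nat -> p = q.
Proof.
case: p q => [[a b] ab] [[a' b'] ab'] /= e1 e2; apply: val_inj => /=.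
by congr (_, _); apply: val_inj.
Qed.

(** * The two special configurations of points *)

Section SpecialPoints.

Variable K : fieldType.

Lemma coef_bipoly s (c : tri s -> K) i j :
  (bipoly c)`_j`_i = \sum_p c p * ((i == (val p).1) && (j == (val p).2))%:R.
Proof.
rewrite /bipoly !coef_sum; apply: eq_bigr => p _.
rewrite /mono2 !coefCM coefXn -mulnb natrM; congr (_ * _).
have [_|_] := eqVneq j; last by rewrite !mulr0 coef0.
by rewrite !mulr1 coefXn.
Qed.

Lemma coef_bipoly_tri s (c : tri s -> K) (p : tri s) : (bipoly c)`_(val p).2`_(val p).1 = c p.
Proof.
rewrite coef_bipoly (bigD1 p) //= !eqxx mulr1 big1 ?addr0 // => q qp.
case: andP => [[/eqP e1 /eqP e2]|_]; last by rewrite mulr0.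
by case/eqP: qp; apply: tri_inj.
Qed.

Lemma tdeg_le_bipoly t (c : tri t.+1 -> K) : tdeg_le t (bipoly c).
Proof.
move=> i j tij; rewrite coef_bipoly big1 // => p _; have := tri_lt p.
by case: andP => [[/eqP <- /eqP <-]|_]; [lia | rewrite mulr0].
Qed.

Lemma bipoly_coefK t (f : {poly {poly K}}) : tdeg_le t f ->
  bipoly (fun p : tri t.+1 => f`_(val p).2`_(val p).1) = f.
Proof.
move=> ft; apply/polyP => j; apply/polyP => i.
have [ijt|tij] := leqP (i + j) t; last by rewrite ft // tdeg_le_bipoly.
have it : (i < t.+1)%N by lia.
have jt : (j < t.+1)%N by lia.
exact: (coef_bipoly_tri (fun p : tri t.+1 => f`_(val p).2`_(val p).1)
  (Sub (Ordinal it, Ordinal jt) ijt)).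
Qed.

Hypothesis charK : [pchar K] =i pred0.

(** With [q = k sigma + x], the degree [m sigma + s] is [s + x + q d] and the valuation [sigma^2 m]
    is [x sigma + q sigma d], as the repeated division requires. *)
Lemma points_without_forms (s x d k : nat) :
    let sigma := d.+1 in let m := (x + k * d)%N in
    (2 * s + 4 <= sigma)%N -> (s + x + 2 <= sigma)%N ->
    ((s + x).+1 * (s + x).+2 <= 2 * (x * sigma))%N ->
  exists pts, family_rank (@jet_family K (sigma ^ 2) m (m * sigma + s).+1 pts) =
              #|tri (m * sigma + s).+1|.
Proof.
move=> sigma m s_le sx_le x_ge; set t := (m * sigma + s)%N.
set n := (sigma ^ 2)%N.
pose psi : {poly K} := contact_graph K d (sigma * d).
have [pts le_rk] := graph_family_rank_le charK n m t.+1 psi.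
exists pts; apply/eqP; rewrite eqn_leq family_rank_le_rows /=.
apply: leq_trans le_rk; rewrite (iffLR (family_rank_free _)) // => c cA.
have tE : t = (s + x + (k * sigma + x) * d)%N.
  by rewrite /t /m /sigma; lia.
have ME : (n * m = x * sigma + (k * sigma + x) * (sigma * d))%N.
  by rewrite /n /m /sigma -mulnn; lia.
have f0 : bipoly c = 0.
  apply: (degenerate_eq0 charK (s := s) (x := x) (d := d) (q := (k * sigma + x)%N)) => //.
    by rewrite -tE; apply: tdeg_le_bipoly.
  rewrite -ME => a b ab.
  have n_gt0 : (0 < n)%N by rewrite /n expn_gt0.
  (* Dividing [a] by [n] gives the index [(i, (a', b))]; weight less than [n m] means
     [a' + b < m]. *)
  have := divn_eq a n; have := ltn_pmod a n_gt0.
  move: (a %/ n)%N (a %% n)%N => a' i il aE.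
  have ab' : (a' + b < m)%N.
    by rewrite -(ltn_pmul2l n_gt0); move: ab; rewrite aE; lia.
  have am : (a' < m)%N by lia.
  have bm : (b < m)%N by lia.
  have := cA (Ordinal il, Sub (Ordinal am, Ordinal bm) ab' : tri m).
  by rewrite /graph_family -graph_coef_bipoly /= aE addnC mulnC.
by move=> p; rewrite -coef_bipoly_tri f0 !coef0.
Qed.

Lemma points_independent (sigma s m : nat) :
    (0 < sigma)%N -> (sigma <= 2 * s + 3)%N ->
  exists pts, family_rank (@jet_family K (sigma ^ 2) m (m * sigma + s).+1 pts) =
              #|{: 'I_(sigma ^ 2) * tri m}|.
Proof.
move=> sigma_gt0 s_ge; set t := (m * sigma + s)%N; set n := (sigma ^ 2)%N.
pose psi : {poly K} := (1 + 'X) ^+ sigma.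
have [pts le_rk] := graph_family_rank_le charK n m t.+1 psi.
exists pts; apply/eqP; rewrite eqn_leq family_rank_le_cols /=.
apply: leq_trans le_rk; rewrite (iffLR (family_rank_full _)) // => h.
pose hb b : {poly K} := \sum_(q : 'I_n * tri m | (val q.2).2 == b :> nat)
  h q *: 'X^(q.1 + n * (val q.2).1).
have [f ft fE] := curve_jets charK m hb sigma_gt0 s_ge.
exists (fun p : tri t.+1 => f`_(val p).2`_(val p).1) => q.
rewrite /graph_family -graph_coef_bipoly bipoly_coefK // /graph_coef.
have lt_q := tri_lt q.2; have lt_i := ltn_ord q.1.
have n_gt0 : (0 < n)%N by rewrite /n expn_gt0 sigma_gt0.
rewrite fE; last by rewrite -/n addnC -ltn_subRL -mulnBr; exact: tri_alpha_lt.
rewrite /hb coef_sum (bigD1 q) //= coefZ coefXn eqxx mulr1 big1 ?addr0 //.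
move=> q' /andP[/eqP bE q'q].
rewrite coefZ coefXn; case: eqP => [aE|_]; last by rewrite mulr0.
have iE : q.1 = q'.1 :> nat.
  have := congr1 (modn^~ n) aE.
  by rewrite ![(_ + n * _)%N]addnC ![(n * _)%N]mulnC !modnMDl !modn_small.
have a'E : (val q.2).1 = (val q'.2).1 :> nat.
  by move/eqP: aE; rewrite iE eqn_add2l eqn_pmul2l // => /eqP.
case/eqP: q'q; case: q q' iE bE a'E {aE lt_q lt_i} => [i q] [i' q'] /= iE bE aE.
by congr (_, _); [apply: val_inj | apply: tri_inj].
Qed.

End SpecialPoints.

(** * Forms and local equations *)

Lemma sum_tri (S : nmodType) s (F : 'I_s * 'I_s -> S) :
  \sum_(p : tri s) F (val p) = \sum_(a < s) \sum_(b < s | (a + b < s)%N) F (a, b).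
Proof.
rewrite pair_big_dep /= (reindex_omap (val : tri s -> _) insub) /=; last first.
  by move=> p ps; rewrite insubT.
by apply: eq_big => [p|p _]; rewrite ?(valP p) ?valK ?eqxx //; case: (val p).
Qed.

Lemma card_tri s : #|tri s| = 'C(s.+1, 2).
Proof.
rewrite -sum1_card (sum_tri (fun=> 1%N)).
rewrite (eq_bigr (fun a : 'I_s => (s - a)%N)) => [|a _]; last first.
  rewrite (eq_bigl (fun b : 'I_s => (b < s - a)%N)) => [|b]; last by rewrite ltn_subRL.
  by rewrite -(big_ord_widen s (fun=> 1%N) (leq_subr a s)) sum1_card card_ord.
have := @sum_subn_large s s (leqnn s); rewrite bin2 /=; move: (\sum_(i < s) _)%N => S; lia.
Qed.

Section BinomialExpansion.

Variables (K : fieldType) (S : comAlgType K) (x y : K).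

Lemma jet_coef_small k l a b : (k < a)%N || (l < b)%N -> jet_coef x y k l a b = 0.
Proof.
by rewrite /jet_coef; case/orP => /bin_small ->; rewrite (mul0n, muln0) mul0r.
Qed.

(** Homogenized Taylor expansion around [(x : y : 1)]. Values in any commutative algebra make it
    usable in every affine chart. *)
Lemma expand_jets (U V Z : S) k l t : (k + l <= t)%N ->
  (U + x *: Z) ^+ k * (V + y *: Z) ^+ l * Z ^+ (t - k - l) =
  \sum_(q : tri t.+1) jet_coef x y k l (val q).1 (val q).2 *:
    (U ^+ (val q).1 * V ^+ (val q).2 * Z ^+ (t - (val q).1 - (val q).2)).
Proof.
move=> klt; rewrite (sum_tri (fun p => jet_coef x y k l p.1 p.2 *:
  (U ^+ p.1 * V ^+ p.2 * Z ^+ (t - p.1 - p.2)))) /=.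
have expand (W : S) z e : (e <= t)%N -> (W + z *: Z) ^+ e =
    \sum_(a < t.+1) ('C(e, a)%:R * z ^+ (e - a)) *: (W ^+ a * Z ^+ (e - a)).
  move=> et; rewrite addrC exprDn.
  rewrite (big_ord_widen t.+1 (fun i => (z *: Z) ^+ (e - i) * W ^+ i *+ 'C(e, i))) //.
  rewrite big_mkcond /=; apply: eq_bigr => a _; case: ltnP => ae.
    by rewrite exprZn -scalerAl -scaler_nat scalerA mulrC [Z ^+ _ * _]mulrC.
  by rewrite bin_small // mul0r scale0r.
rewrite !expand; [|lia..]; rewrite big_distrlr /= mulr_suml; apply: eq_bigr => a _.
rewrite mulr_suml [RHS]big_mkcond /=; apply: eq_bigr => b _.
rewrite -scalerAl -scalerAr scalerA -scalerAl.
have [small|] := boolP ((k < a)%N || (l < b)%N).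
  rewrite (jet_coef_small small) scale0r if_same.
  by case/orP: small => /bin_small ->; rewrite ?mul0r ?mulr0 ?mul0r ?mulr0 scale0r.
rewrite negb_or -!leqNgt => /andP[ak bl].
rewrite (_ : (a + b < t.+1)%N); last by lia.
congr (_ *: _); first by rewrite /jet_coef natrM mulrACA.
rewrite mulrACA -!mulrA -!exprD; congr (_ * (_ * _ ^+ _)); lia.
Qed.

End BinomialExpansion.

Section Order.

Variables (K : fieldType) (n : nat).
Implicit Types (f g : {mpoly K[n]}) (m : nat).

Definition order_ge m f : Prop := {in msupp f, forall a, (m <= mdeg a)%N}.

Lemma order_geP m f : order_ge m f <-> forall a, (mdeg a < m)%N -> f@_a = 0.
Proof.
split=> [fm a am|f0 a]; last by rewrite mcoeff_msupp leqNgt; apply: contra => /f0 ->.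
by apply: memN_msupp_eq0; apply/negP => /fm; rewrite leqNgt am.
Qed.

Lemma order_ge_sum m I (r : seq I) (P : pred I) (F : I -> {mpoly K[n]}) :
  (forall i, P i -> order_ge m (F i)) -> order_ge m (\sum_(i <- r | P i) F i).
Proof.
move=> Fm; apply/order_geP => a am; rewrite linear_sum /= big1 // => i /Fm.
by move/order_geP => ->.
Qed.

Lemma order_geZ m c f : order_ge m f -> order_ge m (c *: f).
Proof.
by move/order_geP => fm; apply/order_geP => a /fm; rewrite mcoeffZ => ->; rewrite mulr0.
Qed.

Lemma order_geW m m' f : (m' <= m)%N -> order_ge m f -> order_ge m' f.
Proof. by move=> mm fm a /fm; apply: leq_trans. Qed.

Lemma order_geM m m' f g : order_ge m f -> order_ge m' g -> order_ge (m + m') (f * g).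
Proof.
move=> fm gm a /msuppM_le/allpairsP[[a1 a2] [/= /fm h1 /gm h2 ->]].
by rewrite mdegD leq_add.
Qed.

Lemma order_ge0 f : order_ge 0 f. Proof. by []. Qed.

Lemma order_geX m f : f@_0%MM = 0 -> order_ge m (f ^+ m).
Proof.
move=> f0; have f1 : order_ge 1 f.
  by apply/order_geP => a; rewrite ltnS leqn0 mdeg_eq0 => /eqP ->.
by elim: m => // m IH; rewrite exprS -add1n; apply: order_geM.
Qed.

End Order.

Section PlaneForms.

Variable K : fieldType.

Definition crd0 : 'I_3 := lift ord_max (ord0 : 'I_2).
Definition crd1 : 'I_3 := lift ord_max (ord_max : 'I_2).
Definition crd2 : 'I_3 := ord_max.

Lemma crdP (Q : 'I_3 -> Prop) : Q crd0 -> Q crd1 -> Q crd2 -> forall i, Q i.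
Proof.
move=> Q0 Q1 Q2 i; have [j ->|->] := unliftP ord_max i => //.
by case: j => [[|[|//]] j]; [move: Q0|move: Q1]; congr Q; apply: val_inj.
Qed.

Lemma prod_crd (S : comNzRingType) (F : 'I_3 -> S) :
  \prod_(i < 3) F i = F crd0 * F crd1 * F crd2.
Proof.
rewrite !big_ord_recr big_ord0 /= mul1r.
by congr (F _ * F _ * F _); apply: val_inj.
Qed.

Definition mnm3 (t : nat) (p : nat * nat) : 'X_{1..3} :=
  [multinom nth 0%N [:: p.1; p.2; (t - p.1 - p.2)%N] i | i < 3].

Lemma mnm3E t p : (mnm3 t p crd0 = p.1) * (mnm3 t p crd1 = p.2) *
  (mnm3 t p crd2 = t - p.1 - p.2)%N.
Proof. by rewrite !mnmE. Qed.

Lemma mdeg3 (a : 'X_{1..3}) : mdeg a = (a crd0 + a crd1 + a crd2)%N.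
Proof.
rewrite mdegE !big_ord_recr big_ord0 /= add0n.
by congr (a _ + a _ + a _)%N; apply: val_inj.
Qed.

Lemma mdeg_mnm3 t (p : tri t.+1) : mdeg (mnm3 t ((val p).1 : nat, (val p).2 : nat)) = t.
Proof. by rewrite mdeg3 !mnm3E /=; case: p => [[[a a_lt] [b b_lt]] /= ab]; lia. Qed.

Definition form_coef t (f : {mpoly K[3]}) (p : tri t.+1) : K :=
  f@_(mnm3 t ((val p).1 : nat, (val p).2 : nat)).

Lemma form_expand t f : f \is t.-homog ->
  f = \sum_(p : tri t.+1) form_coef f p *:
    'X_[mnm3 t ((val p).1 : nat, (val p).2 : nat)].
Proof.
move=> ft; apply/mpolyP => a; rewrite linear_sum /=.
have [at_|/eqP at_] := eqVneq (mdeg a) t; last first.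
  rewrite (dhomog_nemf_coeff ft); last exact/eqP.
  rewrite big1 // => p _; rewrite mcoeffZ mcoeffX; case: eqP => [aE|_]; last by rewrite mulr0.
  by case: at_; rewrite -aE mdeg_mnm3.
have a01 : (a crd0 + a crd1 < t.+1)%N by move: at_; rewrite mdeg3; lia.
have l0 : (a crd0 < t.+1)%N by lia.
have l1 : (a crd1 < t.+1)%N by lia.
pose p0 : tri t.+1 := Sub (Ordinal l0, Ordinal l1) a01.
have aE : mnm3 t ((val p0).1 : nat, (val p0).2 : nat) = a.
  by apply/mnmP; apply: crdP; rewrite !mnm3E //=; move: at_; rewrite mdeg3; lia.
rewrite (bigD1 p0) //= mcoeffZ mcoeffX aE eqxx mulr1 /form_coef aE.
rewrite big1 ?addr0 // => p pp; rewrite mcoeffZ mcoeffX.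
case: eqP => [pE|_]; last by rewrite mulr0.
case/eqP: pp; apply: tri_inj; rewrite /=.
  by rewrite -[RHS](congr1 (fun b : 'X_{1..3} => b crd0) pE) mnm3E.
by rewrite -[RHS](congr1 (fun b : 'X_{1..3} => b crd1) pE) mnm3E.
Qed.

Lemma form_coef_sum t (c : tri t.+1 -> K) p :
  form_coef (\sum_(p : tri t.+1) c p *:
    'X_[mnm3 t ((val p).1 : nat, (val p).2 : nat)]) p = c p.
Proof.
rewrite /form_coef linear_sum (bigD1 p) //= mcoeffZ mcoeffX eqxx mulr1.
rewrite big1 ?addr0 // => q qp; rewrite mcoeffZ mcoeffX.
case: eqP => [pE|_]; last by rewrite mulr0.
case/eqP: qp; apply: tri_inj.
  by have := congr1 (fun b : 'X_{1..3} => b crd0) pE; rewrite !mnm3E.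
by have := congr1 (fun b : 'X_{1..3} => b crd1) pE; rewrite !mnm3E.
Qed.

Lemma homog_sum t (c : tri t.+1 -> K) :
  \sum_(p : tri t.+1) c p *: 'X_[mnm3 t ((val p).1 : nat, (val p).2 : nat)]
    \is t.-homog.
Proof. by apply: rpred_sum => p _; rewrite rpredZ // dhomogX; apply/eqP; exact: mdeg_mnm3. Qed.

End PlaneForms.

Section LocalEquations.

Variable K : fieldType.
Implicit Types (P : point K) (f : {mpoly K[3]}).

Definition affine_pt P : K * K :=
  (hcoord P crd0 / hcoord P crd2, hcoord P crd1 / hcoord P crd2).

Definition form_jet t f (pt : K * K) a b : K :=
  \sum_(p : tri t.+1) form_coef f p * jet_coef pt.1 pt.2 (val p).1 (val p).2 a b.

Definition chart P (i j : 'I_3) : {mpoly K[2]} :=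
  if unlift i j is Some j' then 'X_j' + (hcoord P j / hcoord P i)%:MP else 1.

Lemma chart_coef0 P i j : hcoord P i != 0 ->
  (chart P i j)@_0%MM = hcoord P j / hcoord P i.
Proof.
move=> Pi; rewrite /chart; case: unliftP => [j' _|->].
  by rewrite mcoeffD mcoeffX mcoeffC eqxx mulr1 mnm1_eq0 add0r.
by rewrite mcoeff1 eqxx divff.
Qed.

(** Whichever chart carries the local equation, the coefficients are the jets in the chart [z != 0],
    attached to products of the linear forms [X - x Z] and [Y - y Z]. *)
Lemma local_eq_expand t f P i : f \is t.-homog ->
  local_eq f P i = \sum_(q : tri t.+1) form_jet t f (affine_pt P) (val q).1 (val q).2 *:
    ((chart P i crd0 - (affine_pt P).1 *: chart P i crd2) ^+ (val q).1 *
     (chart P i crd1 - (affine_pt P).2 *: chart P i crd2) ^+ (val q).2 *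
     chart P i crd2 ^+ (t - (val q).1 - (val q).2)).
Proof.
move=> ft; rewrite {1}(form_expand ft) /local_eq linear_sum /=.
under [RHS]eq_bigr => q _ do rewrite scaler_suml.
rewrite exchange_big /=; apply: eq_bigr => p _.
rewrite comp_mpolyZ comp_mpolyX prod_crd !tnth_mktuple -!/(chart P i _) !mnm3E /=.
rewrite -{1}[chart P i crd0](subrK ((affine_pt P).1 *: chart P i crd2)).
rewrite -{1}[chart P i crd1](subrK ((affine_pt P).2 *: chart P i crd2)).
rewrite expand_jets; last by have := tri_lt p; rewrite ltnS.
by rewrite scaler_sumr; apply: eq_bigr => q _; rewrite scalerA.
Qed.

(** In every chart containing [P], [X - x Z] and [Y - y Z] have no constant term, so only jets with
    [a + b < m] could contribute in order below [m]. *)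
Lemma jets_mult_ge t m f P : f \is t.-homog -> hcoord P crd2 != 0 ->
    (forall q : tri m, form_jet t f (affine_pt P) (val q).1 (val q).2 = 0) ->
  mult_ge m f P.
Proof.
move=> ft P2 jet0 i Pi; rewrite -/(order_ge m (local_eq f P i)) (local_eq_expand P i ft).
apply: order_ge_sum => q _; have [qm|qm] := ltnP ((val q).1 + (val q).2) m.
  have l0 : ((val q).1 < m)%N by lia.
  have l1 : ((val q).2 < m)%N by lia.
  rewrite [form_jet _ _ _ _ _](jet0 (Sub (Ordinal l0, Ordinal l1) qm)) scale0r.
  by apply/order_geP => a _; rewrite mcoeff0.
apply: order_geZ.
apply: (order_geW (m := (val q).1 + (val q).2 + 0)); first by rewrite addn0.
apply: order_geM => //; apply: order_geM; apply: order_geX.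
  by rewrite mcoeffB mcoeffZ !chart_coef0 //= mulrA divfK // subrr.
by rewrite mcoeffB mcoeffZ !chart_coef0 //= mulrA divfK // subrr.
Qed.

Lemma mult_ge_jets t m f P : f \is t.-homog -> hcoord P crd2 != 0 ->
  mult_ge m f P ->
  forall q : tri m, form_jet t f (affine_pt P) (val q).1 (val q).2 = 0.
Proof.
move=> ft P2 /(_ _ P2); rewrite -/(order_ge m _) => /order_geP jet0 q.
have [qt|tq] := ltnP ((val q).1 + (val q).2) t.+1; last first.
  rewrite /form_jet big1 // => p _; have := tri_lt p => pt.
  rewrite jet_coef_small ?mulr0 //; apply/orP.
  by case: (ltnP (val p).1 (val q).1) => ?; [left|right; lia].
have l0 : ((val q).1 < t.+1)%N by lia.
have l1 : ((val q).2 < t.+1)%N by lia.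
pose q' : tri t.+1 := Sub (Ordinal l0, Ordinal l1) qt.
pose a (u v : nat) := (U_(ord0 : 'I_2) *+ u + U_(ord_max : 'I_2) *+ v)%MM.
have a0 u v : a u v ord0 = u by rewrite !mnmDE !mulmnE !mnm1E -!val_eqE /=; lia.
have a1 u v : a u v ord_max = v by rewrite !mnmDE !mulmnE !mnm1E -!val_eqE /=; lia.
have := jet0 (a (val q).1 (val q).2).
rewrite mdegD !mdegMn !mdeg1 !mul1n => /(_ (tri_lt q)).
(* In the chart [z != 0] the two linear forms become the variables and [Z] becomes 1. *)
have monE (u v : nat) : (chart P crd2 crd0 - (affine_pt P).1 *: chart P crd2 crd2) ^+ u *
     (chart P crd2 crd1 - (affine_pt P).2 *: chart P crd2 crd2) ^+ v *
     chart P crd2 crd2 ^+ (t - u - v) = 'X_[a u v].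
  rewrite /chart unlift_none !liftK expr1n mulr1 -!mul_mpolyC !mulr1 !addrK.
  by rewrite mpolyXD -!mpolyXn.
rewrite (local_eq_expand P crd2 ft) linear_sum (bigD1 q') //=.
rewrite mcoeffZ monE mcoeffX eqxx mulr1 big1 ?addr0 // => r rq.
rewrite mcoeffZ monE mcoeffX; case: eqP => [rE|_]; last by rewrite mulr0.
case/eqP: rq; apply: tri_inj; rewrite /=.
  by rewrite -(a0 (val r).1 (val r).2) rE a0.
by rewrite -(a1 (val r).1 (val r).2) rE a1.
Qed.

End LocalEquations.

(** * From maximal rank to the Hilbert function *)

Section MaximalRank.

Variables (K : fieldType) (n m : nat).
Implicit Types (P : 'I_n -> point K) (pts : 'I_n -> K * K) (t : nat).

(** Multiplicity at least [m] survives sums and products with arbitrary polynomials, so the ideal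
    has no further elements. *)
Lemma fat_piece_mult P t (f : dhomog 3 K t) :
  f \in fat_piece P m t <-> forall i, mult_ge m f (P i).
Proof.
split=> [/fat_pieceP[s fat_s ->] i j Pj | fP].
  rewrite /local_eq linear_sum /= big_seq; apply: order_ge_sum => q qs.
  rewrite rmorphM /= -[m]add0n; apply: order_geM; first exact: order_ge0.
  by have [_ /(_ i j Pj)] := fat_s q qs.
apply/fat_pieceP; exists [:: (1, f : {mpoly K[3]})]; last by rewrite big_seq1 mul1r.
by move=> q; rewrite inE => /eqP ->; split=> //; exists t; apply: dhomog_is_dhomog.
Qed.

Definition affine_pts P (i : 'I_n) : K * K := affine_pt (P i).

Definition jets_row pts t (f : dhomog 3 K t) : 'rV[K]_#|{: 'I_n * tri m}| :=
  \row_j \sum_(p : tri t.+1) form_coef f p * jet_family pts p (enum_val j).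

Fact jets_row_linear pts t : linear (@jets_row pts t).
Proof.
move=> c f g; apply/rowP => j; rewrite !mxE mulr_sumr -big_split /=.
by apply: eq_bigr => p _; rewrite /form_coef mcoeffD mcoeffZ; ring.
Qed.

HB.instance Definition _ pts t := GRing.isLinear.Build K (dhomog 3 K t)
  'rV[K]_#|{: 'I_n * tri m}| _ (@jets_row pts t) (@jets_row_linear pts t).

Lemma fat_piece_ker P t (f : dhomog 3 K t) : (forall i, hcoord (P i) crd2 != 0) ->
  (f \in fat_piece P m t) = (jets_row (affine_pts P) f == 0).
Proof.
move=> P2; apply/idP/eqP => [/fat_piece_mult fP | f0].
  apply/rowP => j; rewrite !mxE; case: (enum_val j) => i q.
  exact: (mult_ge_jets (dhomog_is_dhomog f) (P2 i) (fP i) q).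
apply/fat_piece_mult => i; apply: (jets_mult_ge (dhomog_is_dhomog f) (P2 i)) => q.
have := congr1 (fun v : 'rV_#|{: 'I_n * tri m}| => v 0 (enum_rank (i, q))) f0.
by rewrite !mxE enum_rankK.
Qed.

Lemma hilb_free P t : (forall i, hcoord (P i) crd2 != 0) ->
    family_rank (@jet_family K n m t.+1 (affine_pts P)) = #|tri t.+1| ->
  hilb P m t = 0%N.
Proof.
move=> P2 /family_rank_free free; apply/eqP; rewrite dimv_eq0 -subv0.
apply/subvP => f; rewrite fat_piece_ker // => /eqP f0; rewrite memv0; apply/eqP/val_inj.
rewrite /= (form_expand (dhomog_is_dhomog f)) big1 // => p _.
rewrite (free (form_coef f)) ?scale0r // => q.
have := congr1 (fun v : 'rV_#|{: 'I_n * tri m}| => v 0 (enum_rank q)) f0.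
by rewrite !mxE enum_rankK.
Qed.

Lemma hilb_full P t : (forall i, hcoord (P i) crd2 != 0) ->
    family_rank (@jet_family K n m t.+1 (affine_pts P)) = #|{: 'I_n * tri m}| ->
  (hilb P m t + #|{: 'I_n * tri m}|)%N = #|tri t.+1|.
Proof.
move=> P2 /family_rank_full full; pose phi := linfun (@jets_row (affine_pts P) t).
have -> : hilb P m t = \dim (lker phi).
  rewrite /hilb; congr (\dim _); apply/vspaceP => f.
  by rewrite memv_ker lfunE /= fat_piece_ker.
have limgE : limg phi = fullv.
  apply/vspaceP => v; rewrite memvf; apply/memv_imgP.
  have [c cE] := full (fun q => v 0 (enum_rank q)).
  exists (DHomog (homog_sum c)); first by rewrite memvf.
  rewrite lfunE /=; apply/rowP => j; rewrite mxE -[j in LHS]enum_valK -cE.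
  by apply: eq_bigr => p _; rewrite form_coef_sum.
have := limg_ker_dim phi fullv; rewrite capfv limgE !dimvf /dim /= mul1n => ->.
by rewrite card_tri -(bin_sub (leq_addr 2 t)) addKn addn2.
Qed.

(** Degree at most [t] implies degree at most [t']: absence of forms passes down in degree, and
    likewise independence passes up in [jet_family_full]. *)
Lemma jet_family_free pts t t' : (t <= t')%N ->
    family_rank (@jet_family K n m t'.+1 pts) = #|tri t'.+1| ->
  family_rank (@jet_family K n m t.+1 pts) = #|tri t.+1|.
Proof.
move=> tt' /family_rank_free free; apply/family_rank_free => c c0.
have ct' : tdeg_le t' (bipoly c).
  by move=> i j ij; apply: tdeg_le_bipoly; apply: leq_ltn_trans ij.
move=> p; rewrite -coef_bipoly_tri -(bipoly_coefK ct') coef_bipoly big1 // => q _.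
rewrite (free (fun q : tri t'.+1 => (bipoly c)`_(val q).2`_(val q).1)) ?mul0r // => r.
rewrite -coef_taylor_bipoly bipoly_coefK //.
by rewrite coef_taylor_bipoly; exact: c0.
Qed.

Lemma jet_family_full pts t t' : (t <= t')%N ->
    family_rank (@jet_family K n m t.+1 pts) = #|{: 'I_n * tri m}| ->
  family_rank (@jet_family K n m t'.+1 pts) = #|{: 'I_n * tri m}|.
Proof.
move=> tt' /family_rank_full full; apply/family_rank_full => h.
have [c cE] := full h; exists (fun p : tri t'.+1 => (bipoly c)`_(val p).2`_(val p).1) => q.
have ct' : tdeg_le t' (bipoly c).
  by move=> i j ij; apply: tdeg_le_bipoly; apply: leq_ltn_trans ij.
by rewrite -coef_taylor_bipoly bipoly_coefK // coef_taylor_bipoly; exact: cE.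
Qed.

(** Two consecutive degrees decide all others: up to [t0] there are at least as many conditions as
    coefficients, and beyond [t0] the rank-nullity formula gives the difference, which is then
    nonnegative. *)
Lemma hilb_expected P t0 : (forall i, hcoord (P i) crd2 != 0) ->
    family_rank (@jet_family K n m t0.+1 (affine_pts P)) = #|tri t0.+1| ->
    family_rank (@jet_family K n m t0.+2 (affine_pts P)) = #|{: 'I_n * tri m}| ->
  forall t, (hilb P m t)%:Z = Num.max 0 ('C(t + 2, 2)%:Z - n%:Z * 'C(m + 1, 2)%:Z).
Proof.
move=> P2 free full t; rewrite addn2 addn1 -!card_tri -PoszM.
have cardE : #|{: 'I_n * tri m}| = (n * #|tri m|)%N by rewrite card_prod card_ord.
have [tt0|t0t] := leqP t t0.
  have free_t := jet_family_free tt0 free.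
  rewrite (hilb_free P2 free_t) max_l // subr_le0 lez_nat -cardE -free_t.
  exact: family_rank_le_cols.
have := hilb_full P2 (jet_family_full t0t full); rewrite cardE => <-.
by rewrite PoszD addrK max_r.
Qed.

End MaximalRank.

(** * Openness of the rank conditions *)

Lemma mxvec_index_inj n k (i i' : 'I_n) (j j' : 'I_k) :
  mxvec_index i j = mxvec_index i' j' -> (i, j) = (i', j').
Proof.
move=> E; pose A : 'M[bool]_(n, k) := \matrix_(u, v) ((u, v) == (i, j)).
have := mxvecE A i j; rewrite E mxvecE !mxE eqxx.
by move/eqP => ->.
Qed.

Lemma eq_mxvec_index n k (i i' : 'I_n) (j j' : 'I_k) :
  (mxvec_index i j == mxvec_index i' j') = (i == i') && (j == j').
Proof.
by rewrite -xpair_eqE; apply/eqP/eqP => [/mxvec_index_inj|[-> ->]].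
Qed.

Section Multihomogeneous.

Variables (K : fieldType) (n : nat).
Implicit Types (F G : {mpoly K[n * 3]}) (d : 'I_n -> nat) (P : 'I_n -> point K).

Definition multideg d F : Prop :=
  forall a : 'X_{1..n * 3}, F@_a != 0 ->
    forall i, (\sum_(j < 3) a (mxvec_index i j))%N = d i.

Lemma multidegP d F : multideg d F -> multihomog F.
Proof. by move=> Fd; exists d => a; rewrite mcoeff_msupp => /Fd. Qed.

Lemma eq_multideg d d' F : multideg d F -> d =1 d' -> multideg d' F.
Proof. by move=> Fd dd a /Fd Fa i; rewrite -dd. Qed.

Lemma multideg_sum d I (r : seq I) (P : pred I) (F : I -> {mpoly K[n * 3]}) :
  (forall i, P i -> multideg d (F i)) -> multideg d (\sum_(i <- r | P i) F i).
Proof.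
move=> Fd a Fa i; apply/eqP/negPn/negP => ne; case/eqP: Fa.
rewrite linear_sum /= big1 // => k /Fd/(_ a) Fk; apply/eqP/negPn/negP => /Fk/(_ i) E.
by rewrite E eqxx in ne.
Qed.

Lemma multidegZ d c F : multideg d F -> multideg d (c *: F).
Proof. by move=> Fd a; rewrite mcoeffZ mulf_eq0 negb_or => /andP[_ /Fd]. Qed.

Lemma multidegM d d' F G : multideg d F -> multideg d' G ->
  multideg (fun i => d i + d' i)%N (F * G).
Proof.
move=> Fd Gd a; rewrite -mcoeff_msupp => /msuppM_le/allpairsP[[a1 a2] /= [h1 h2 ->]] i.
rewrite !mcoeff_msupp in h1 h2; rewrite -(Fd _ h1) -(Gd _ h2) -big_split /=.
by apply: eq_bigr => j _; rewrite mnmDE.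
Qed.

Lemma multideg1 : multideg (fun=> 0%N) 1.
Proof.
move=> a; rewrite mcoeff1; have [-> _ i|_] := eqVneq a 0%MM; last by rewrite eqxx.
by rewrite big1 // => j _; rewrite mnm0E.
Qed.

Lemma multideg_prod I (r : seq I) (d : I -> 'I_n -> nat) (F : I -> {mpoly K[n * 3]}) :
  (forall k, multideg (d k) (F k)) ->
  multideg (fun i => \sum_(k <- r) d k i)%N (\prod_(k <- r) F k).
Proof.
move=> Fd; elim: r => [|k r IH].
  by rewrite big_nil; apply: (eq_multideg multideg1) => i; rewrite big_nil.
rewrite big_cons; apply: (eq_multideg (multidegM (Fd k) IH)) => i.
by rewrite big_cons.
Qed.

(** Every term of the determinant takes one entry from each column, so the column degrees add up. *)
Lemma multideg_det r (A : 'M[{mpoly K[n * 3]}]_r) (d : 'I_r -> 'I_n -> nat) :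
  (forall i j, multideg (d j) (A i j)) ->
  multideg (fun i => \sum_j d j i)%N (\det A).
Proof.
move=> Ad; apply: multideg_sum => s _.
have sd : multideg (fun i => \sum_j d j i)%N (\prod_i A i (s i)).
  apply: (eq_multideg (@multideg_prod _ (index_enum _) (fun k => d (s k))
    (fun k => A k (s k)) (fun k => Ad k (s k)))) => i.
  by rewrite [RHS](reindex_inj (@perm_inj _ s)).
by rewrite mulr_sign; case: ifP => // _; rewrite -scaleN1r; apply: multidegZ.
Qed.

Definition pt_mnm (i0 : 'I_n) (u v w : nat) : 'X_{1..n * 3} :=
  (U_(mxvec_index i0 crd0) *+ u + U_(mxvec_index i0 crd1) *+ v
     + U_(mxvec_index i0 crd2) *+ w)%MM.

Lemma multideg_pt_mnm i0 (u v w : nat) :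
  multideg (fun i => if i == i0 then u + v + w else 0)%N 'X_[pt_mnm i0 u v w].
Proof.
move=> a; rewrite mcoeffX; have [<- _ i|_] := eqVneq (pt_mnm i0 u v w) a; last by rewrite eqxx.
rewrite !big_ord_recr big_ord0 /= add0n !mnmDE !mulmnE !mnm1E.
by rewrite !eq_mxvec_index [i == i0]eq_sym; case: (i0 == i); rewrite -?val_eqE /=; lia.
Qed.

Definition coords P (l : 'I_(n * 3)) : K := mxvec (\matrix_(i < n, j < 3) hcoord (P i) j) 0 l.

Lemma coordsE P i j : coords P (mxvec_index i j) = hcoord (P i) j.
Proof. by rewrite /coords mxvecE mxE. Qed.

Lemma meval_pt_mnm P i0 u v w : ('X_[pt_mnm i0 u v w]).@[coords P] =
  hcoord (P i0) crd0 ^+ u * hcoord (P i0) crd1 ^+ v * hcoord (P i0) crd2 ^+ w.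
Proof.
by rewrite !mpolyXD !mevalM -!mpolyXn !rmorphXn /= !mevalXU !coordsE.
Qed.

Variable m : nat.

(** The jet coefficient at the affine point times [z^t], which clears the denominators. *)
Definition jet_mpoly t (p : tri t.+1) (q : 'I_n * tri m) : {mpoly K[n * 3]} :=
  ('C((val p).1, (val q.2).1) * 'C((val p).2, (val q.2).2))%:R *:
    'X_[pt_mnm q.1 ((val p).1 - (val q.2).1) ((val p).2 - (val q.2).2)
          ((val q.2).1 + (val q.2).2 + (t - (val p).1 - (val p).2))].

Lemma multideg_jet_mpoly t (p : tri t.+1) q :
  multideg (fun i => if i == q.1 then t else 0)%N (jet_mpoly p q).
Proof.
rewrite /jet_mpoly; have := tri_lt p; move: (val p).1 (val p).2 => k l kl.
move: (val q.2).1 (val q.2).2 => a b.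
have [small|] := boolP ((k < a)%N || (l < b)%N).
  move=> c; suff -> : ('C(k, a) * 'C(l, b))%N = 0%N by rewrite scale0r mcoeff0 eqxx.
  by case/orP: small => /bin_small ->; rewrite ?muln0.
rewrite negb_or -!leqNgt => /andP[ak bl]; apply: multidegZ.
have D := @multideg_pt_mnm q.1 (k - a) (l - b) (a + b + (t - k - l)).
apply: (eq_multideg D) => i; case: eqP => // _.
by move: kl; rewrite ltnS; lia.
Qed.

Lemma meval_jet_mpoly P t (p : tri t.+1) q : hcoord (P q.1) crd2 != 0 ->
  (jet_mpoly p q).@[coords P] =
  hcoord (P q.1) crd2 ^+ t * jet_family (affine_pts P) p q.
Proof.
move=> P2; rewrite /jet_mpoly mevalZ meval_pt_mnm /jet_family.
have := tri_lt p; move: (val p).1 (val p).2 => k l kl.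
move: (val q.2).1 (val q.2).2 => a b.
have [small|] := boolP ((k < a)%N || (l < b)%N).
  rewrite jet_coef_small // mulr0.
  suff -> : ('C(k, a) * 'C(l, b))%N = 0%N by rewrite mul0r.
  by case/orP: small => /bin_small ->; rewrite ?muln0.
rewrite negb_or -!leqNgt => /andP[ak bl].
rewrite /jet_coef /affine_pts /affine_pt /= !expr_div_n.
set z := hcoord _ crd2; have tE : (t = (a + b + (t - k - l)) + (k - a) + (l - b))%N.
  by move: kl; rewrite ltnS; lia.
rewrite [in z ^+ t]tE !exprD.
have zk : z ^+ (k - a) != 0 by rewrite expf_neq0.
have zl : z ^+ (l - b) != 0 by rewrite expf_neq0.
by field; rewrite zk zl.
Qed.

Lemma family_rank_jet_mpoly P t : (forall i, hcoord (P i) crd2 != 0) ->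
  family_rank (fun (p : tri t.+1) q => (jet_mpoly p q).@[coords P]) =
  family_rank (@jet_family K n m t.+1 (affine_pts P)).
Proof.
move=> P2; apply/eqP; rewrite eqn_leq; apply/andP; split.
all: apply: family_rank_le => c c0 q; have := c0 q.
  move=> /(congr1 ( *%R (hcoord (P q.1) crd2 ^+ t))); rewrite mulr0 mulr_sumr => E.
  by rewrite -[RHS]E; apply: eq_bigr => p _; rewrite meval_jet_mpoly // mulrCA.
move=> E; apply: (mulfI (expf_neq0 t (P2 q.1))); rewrite mulr0 mulr_sumr -[RHS]E.
by apply: eq_bigr => p _; rewrite meval_jet_mpoly // mulrCA.
Qed.

(* A maximal nonvanishing minor at P0, taken on columns: column operations would mix
   the degrees in the different points, whereas rows may be combined freely. *)
Lemma rank_open P0 t : (forall i, hcoord (P0 i) crd2 != 0) ->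
  exists F d, [/\ multideg d F, F.@[coords P0] != 0 &
    forall P, (forall i, hcoord (P i) crd2 != 0) -> F.@[coords P] != 0 ->
      (family_rank (@jet_family K n m t.+1 (affine_pts P0)) <=
       family_rank (@jet_family K n m t.+1 (affine_pts P)))%N].
Proof.
move=> P02; pose M P := family_mx (fun (p : tri t.+1) q => (jet_mpoly p q).@[coords P]).
have [f [B BM]] := rank_minor (erefl (\rank (M P0))).
pose A := map_mx (@mpolyC _ K) B *m colsub f (family_mx (@jet_mpoly t)).
have AE P : (\det A).@[coords P] = \det (B *m colsub f (M P)).
  rewrite -[LHS]/((meval (coords P)) (\det A)) -det_map_mx map_mxM -map_mx_comp.
  congr (\det (_ *m _)); first by apply/matrixP => i j; rewrite !mxE /= mevalC.
  by apply/matrixP => i j; rewrite !mxE.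
exists (\det A); exists (fun i => \sum_j (if i == (enum_val (f j)).1 then t else 0))%N.
split.
- apply: multideg_det => i j; rewrite mxE; apply: multideg_sum => k _.
  by rewrite !mxE mul_mpolyC; apply: multidegZ; exact: multideg_jet_mpoly.
- by rewrite AE BM det1 oner_eq0.
move=> P P2; rewrite AE => /rank_ge_minor.
by rewrite -!family_rank_jet_mpoly.
Qed.

End Multihomogeneous.

(** * Passage to general points *)

Section GeneralPoints.

Variable K : fieldType.
Hypothesis charK : [pchar K] =i pred0.

Definition point_of (a : K * K) : 'rV[K]_3 := \row_j nth 0 [:: a.1; a.2; 1] j.

Lemma point_of_neq0 a : point_of a != 0.
Proof. by apply/eqP => /rowP/(_ crd2); rewrite !mxE; apply/eqP; rewrite oner_eq0. Qed.

Definition mk_point a : point K := exist _ (point_of a) (point_of_neq0 a).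

Lemma mk_pointE a : (hcoord (mk_point a) crd0 = a.1) *
  (hcoord (mk_point a) crd1 = a.2) * (hcoord (mk_point a) crd2 = 1).
Proof. by rewrite /hcoord !mxE. Qed.

Lemma mk_point_z n (pts : 'I_n -> K * K) i : hcoord (mk_point (pts i)) crd2 != 0.
Proof. by rewrite mk_pointE oner_eq0. Qed.

Lemma family_rank_mk_point n m s (pts : 'I_n -> K * K) :
  family_rank (@jet_family K n m s (affine_pts (mk_point \o pts))) =
  family_rank (@jet_family K n m s pts).
Proof.
congr (\rank _); apply/matrixP => i j; rewrite !mxE /jet_family /affine_pts /affine_pt /=.
by rewrite !mk_pointE !divr1.
Qed.

Lemma horner_mmap N (F : {mpoly K[N]}) (h : 'I_N -> {poly K}) e :
  (mmap polyC h F).[e] = F.@[fun l => (h l).[e]].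
Proof.
rewrite mevalE /mmap horner_sum; apply: eq_bigr => a _.
rewrite hornerM hornerC /mmap1 horner_prod; congr (_ * _).
by apply: eq_bigr => l _; rewrite horner_exp.
Qed.

(** On the line joining [A] to [B], each of [F] and [G] becomes a nonzero polynomial in one
    parameter, and their product has a nonroot. *)
Lemma common_nonroot n (F G : {mpoly K[n * 3]}) (A B : 'I_n -> K * K) :
    F.@[coords (mk_point \o A)] != 0 -> G.@[coords (mk_point \o B)] != 0 ->
  exists C : 'I_n -> K * K,
    F.@[coords (mk_point \o C)] != 0 /\ G.@[coords (mk_point \o C)] != 0.
Proof.
move=> FA GB.
pose C e i : K * K := ((A i).1 + e * ((B i).1 - (A i).1), (A i).2 + e * ((B i).2 - (A i).2)).
pose h l : {poly K} := (coords (mk_point \o A) l)%:P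
  + (coords (mk_point \o B) l - coords (mk_point \o A) l) *: 'X.
have hE e l : (h l).[e] = coords (mk_point \o C e) l.
  rewrite /h hornerD hornerZ hornerX hornerC; case/mxvec_indexP: l => i j.
  rewrite !coordsE /=; move: j; apply: crdP; rewrite !mk_pointE /C /=; ring.
have evalE (H : {mpoly K[n * 3]}) e : (mmap polyC h H).[e] = H.@[coords (mk_point \o C e)].
  by rewrite horner_mmap; apply: meval_eq => l; apply: hE.
have C0 : coords (mk_point \o C 0) =1 coords (mk_point \o A).
  by move=> l; rewrite -hE /h hornerD hornerZ hornerX hornerC mulr0 addr0.
have C1 : coords (mk_point \o C 1) =1 coords (mk_point \o B).
  by move=> l; rewrite -hE /h hornerD hornerZ hornerX hornerC mulr1 addrC subrK.
have nz : mmap polyC h F * mmap polyC h G != 0.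
  rewrite mulf_neq0 //.
    by apply: contra_neq FA => F0; rewrite -(meval_eq _ C0) -evalE F0 horner0.
  by apply: contra_neq GB => G0; rewrite -(meval_eq _ C1) -evalE G0 horner0.
have [e] := poly_nonroot charK nz.
by rewrite hornerM mulf_eq0 negb_or !evalE => /andP[Fe Ge]; exists (C e).
Qed.

Lemma general_hilb n m t0 (A B : 'I_n -> K * K) :
    family_rank (@jet_family K n m t0.+1 A) = #|tri t0.+1| ->
    family_rank (@jet_family K n m t0.+2 B) = #|{: 'I_n * tri m}| ->
  for_general_points (fun P : 'I_n -> point K => forall t,
    (hilb P m t)%:Z = Num.max 0 ('C(t + 2, 2)%:Z - n%:Z * 'C(m + 1, 2)%:Z)).
Proof.
move=> rkA rkB.
have [F [dF [Fd FA Frk]]] := @rank_open K n m (mk_point \o A) t0 (mk_point_z A).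
have [G [dG [Gd GB Grk]]] := @rank_open K n m (mk_point \o B) t0.+1 (mk_point_z B).
(* Nonvanishing of [Z] keeps all points in the chart [z != 0], where the ranks are computed. *)
pose Z : {mpoly K[n * 3]} := \prod_i 'X_[pt_mnm i 0 0 1].
have ZE P : Z.@[coords P] = \prod_i hcoord (P i) crd2.
  by rewrite rmorph_prod /=; apply: eq_bigr => i _; rewrite meval_pt_mnm !expr0 !mul1r.
exists (fun P => eval_points (F * G * Z) P != 0); split.
- exists (eq (F * G * Z)) => [_ <-|P]; last by split=> [|[_ <-]] //; exists (F * G * Z).
  have Zd := @multideg_prod K n _ (index_enum 'I_n) _ _
    (fun i => @multideg_pt_mnm K n i 0 0 1).
  exact: multidegP (multidegM (multidegM Fd Gd) Zd).
- have [C [FC GC]] := common_nonroot FA GB; exists (mk_point \o C).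
  rewrite /eval_points -/(coords _) !rmorphM /= !mulf_neq0 //.
  by rewrite ZE; apply/prodf_neq0 => i _; apply: mk_point_z.
move=> P; rewrite /eval_points -/(coords P) !mevalM !mulf_eq0 !negb_or.
move=> /andP[/andP[FP GP]]; rewrite ZE => /prodf_neq0 ZP.
have P2 i : hcoord (P i) crd2 != 0 by apply: ZP.
apply: (hilb_expected (t0 := t0) P2).
  apply/eqP; rewrite eqn_leq family_rank_le_rows /=.
  by have := Frk P P2 FP; rewrite family_rank_mk_point rkA.
apply/eqP; rewrite eqn_leq family_rank_le_cols /=.
by have := Grk P P2 GP; rewrite family_rank_mk_point rkB.
Qed.

End GeneralPoints.

(* With sigma = 2h and j = h - x, or sigma = 2h - 1 and j = h - x, the last inequality
   is j (j + 1) <= sigma, respectively j (j + 1) <= 2 sigma. *)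
Lemma even_parameters (h l : nat) (x : int) :
    (2 <= h)%N -> (l * l.+1 <= 2 * h)%N -> h%:Z - l%:Z <= x <= h%:Z ->
  exists x' s : nat, [/\ x = x', (2 * s + 4 <= 2 * h)%N, (2 * h <= 2 * s.+1 + 3)%N,
    (s + x' + 2 <= 2 * h)%N & ((s + x').+1 * (s + x').+2 <= 2 * (x' * (2 * h)))%N].
Proof.
move=> h_ge2 l_le /andP[x_lo x_hi].
(* This makes [x] nonnegative. *)
have lh : (l <= h)%N by rewrite leqNgt; apply/negP => hl; nia.
have [x' xE] : exists x' : nat, x = x' by exists `|x|%N; lia.
(* [s = h - 2] solves [2 s + 4 = 2 h]. *)
rewrite xE in x_lo x_hi; exists x', (h - 2)%N; split; [by []|lia|lia|lia|].
have [j hj] : exists j, h = (x' + j)%N by exists (h - x')%N; lia.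
have jl : (j * j.+1 <= l * l.+1)%N by apply: leq_mul; lia.
have : ((h - 2 + x').+2 = 2 * x' + j)%N by lia.
move: (h - 2 + x')%N => a aE; have := congr2 muln aE aE; move: jl l_le; rewrite hj; lia.
Qed.

Lemma odd_parameters (h l : nat) (x : int) :
    (3 <= h)%N -> (l * l.+1 <= 2 * (2 * h - 1))%N -> h%:Z - l%:Z <= x <= h%:Z ->
  exists x' s : nat, [/\ x = x', (2 * s + 4 <= 2 * h - 1)%N,
    (2 * h - 1 <= 2 * s.+1 + 3)%N, (s + x' + 2 <= 2 * h - 1)%N &
    ((s + x').+1 * (s + x').+2 <= 2 * (x' * (2 * h - 1)))%N].
Proof.
move=> h_ge3 l_le /andP[x_lo x_hi].
have lh : (l <= h)%N by rewrite leqNgt; apply/negP => hl; nia.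
have [x' xE] : exists x' : nat, x = x' by exists `|x|%N; lia.
(* [s = h - 3] solves [2 s + 5 = 2 h - 1]. *)
rewrite xE in x_lo x_hi; exists x', (h - 3)%N; split; [by []|lia|lia|lia|].
have [j hj] : exists j, h = (x' + j)%N by exists (h - x')%N; lia.
have jl : (j * j.+1 <= l * l.+1)%N by apply: leq_mul; lia.
have : ((h - 3 + x').+3 = 2 * x' + j)%N by lia.
move: (h - 3 + x')%N => a aE; have := congr2 muln aE aE.
rewrite mulnBr; move: jl l_le; rewrite hj; lia.
Qed.

Theorem mainTheorem5 (R : realType) (sigma n k m : nat) (x : int)
    (sigma_gt0 : (0 < sigma)%N)
    (nE : n = (sigma ^ 2)%N)
    (n_ge10 : (10 <= n)%N)
    (x_even : ~~ odd sigma ->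
       (sigma./2)%:Z - (ell sigma)%:Z <= x <= (sigma./2)%:Z)
    (x_odd : odd sigma ->
       (sigma.+1./2)%:Z - (ell (2 * sigma))%:Z <= x <= (sigma.+1./2)%:Z)
    (mE : m%:Z = x + k%:Z * (sigma%:Z - 1)) :
  for_general_points (fun P : 'I_n -> point R[i] =>
    forall t : nat,
      (hilb P m t)%:Z =
        Num.max 0 ('C(t + 2, 2)%:Z - n%:Z * 'C(m + 1, 2)%:Z)).
Proof.
have [x' [s [xE s_le s_ge sx_le x_ge]]] : exists x' s : nat,
    [/\ x = x', (2 * s + 4 <= sigma)%N, (sigma <= 2 * s.+1 + 3)%N,
      (s + x' + 2 <= sigma)%N & ((s + x').+1 * (s + x').+2 <= 2 * (x' * sigma))%N].
  have sigma_ge4 : (4 <= sigma)%N.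
    rewrite leqNgt; apply/negP => sigma_lt; move: n_ge10; rewrite nE.
    by case: sigma sigma_lt {x_even x_odd mE nE sigma_gt0} => [|[|[|[|]]]].
  have := odd_double_half sigma; rewrite -mul2n.
  have [odd_s /= sE|/negPf odd_s /= sE] := boolP (odd sigma).
    have [l_le _] := ellP (2 * sigma); have := x_odd odd_s.
    move: (ell (2 * sigma)) l_le => l.
    have [h hE sE'] : exists2 h, sigma.+1./2 = h & sigma = (2 * h - 1)%N.
      by exists sigma.+1./2 => //; lia.
    by rewrite hE sE' => l_le; apply: odd_parameters => //; lia.
  have [l_le _] := ellP sigma; have := x_even (negbT odd_s).
  rewrite add0n in sE; move: (ell sigma) l_le => l.
  have [h hE sE'] : exists2 h, sigma./2 = h & sigma = (2 * h)%N by exists sigma./2.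
  rewrite hE sE' => l_le.
  by apply: even_parameters => //; lia.
pose d := sigma.-1; have dE : sigma = d.+1 by rewrite prednK.
have {}mE : m = (x' + k * d)%N by move: mE; rewrite xE dE; lia.
have charC : [pchar R[i]] =i pred0 by apply: pchar_num.
rewrite nE mE dE.
rewrite dE in s_le s_ge sx_le x_ge.
(* [A] excludes forms in degree [m sigma + s]; [B] gives independence one degree higher, with
   [s + 1] in place of [s]. *)
have [A rkA] := points_without_forms charC k s_le sx_le x_ge.
have [B rkB] := @points_independent R[i] charC d.+1 s.+1 (x' + k * d) isT s_ge.
rewrite addnS in rkB.
exact: (general_hilb charC rkA rkB).
Qed.
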